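(* For every $m\ge1$, $$Z_m(x_1,\dots,x_m)=H_m(x)\sum_{r=0}^{\lfloor m/2\rfloor}\left(\frac{1}{-ac}\right)^r\sum_{S\subseteq\{1,\dots,m\},\,|S|=2r}\ \prod_{i\in S}\frac{h(x_i)}{1-h(x_i)}\prod_{i\in S,\,j\in\bar S}\frac{1-x_ix_j}{x_i-x_j}\;Z^K_{2r}(x_S),$$ where $H_m(x)=\prod_{i=1}^m(1-h(x_i))$, $\bar S$ is the complement of $S$ in $\{1,\dots,m\}$, $x_S$ is the alphabet $(x_i)_{i\in S}$, and $Z^K_{2r}(x_S)$ denotes $Z_{2r}(x_S)$ evaluated at $a=1$, $c=-1$ (with $Z^K_0=1$).
   Context: Fix complex $q,a,c$. Edge states in $\{0,1\}$. Bulk weights $R_z(i,j;k,l)$: $1$ for $(0,0,0,0)$, $(1,1,1,1)$; $\frac{q(1-z)}{1-qz}$ for $(1,0,1,0)$; $\frac{1-q}{1-qz}$ for $(1,0,0,1)$; $\frac{1-z}{1-qz}$ for $(0,1,0,1)$; $\frac{z(1-q)}{1-qz}$ for $(0,1,1,0)$; $0$ otherwise ($i$ incoming bottom, $j$ incoming left, $k$ outgoing top, $l$ outgoing right). $h(x)=\frac{ac(1-x^2)}{(a-x)(c-x)}$, $K_x(0;0)=1-h(x)$, $K_x(0;1)=h(x)$, $K_x(1;0)=-h(x)/(ac)$, $K_x(1;1)=1+h(x)/(ac)$ (incoming; outgoing). $Z_0=1$; $Z_m(x_1,\dots,x_m)$ is the partition function of the lattice with $m$ upward lines: line $i$ (parameter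 $x_i$) enters from the bottom in state $0$, crosses horizontal rows $1,\dots,i-1$, meets a boundary vertex of weight $K_{x_i}(s;s')$ ($s$ arriving from below, $s'$ leaving to the right), then continues as horizontal row $i$ moving right across vertical lines $i+1,\dots,m$ and exits on the right in state $0$. The crossing of vertical line $i$ with row $j$ ($j<i$) has weight $R_{x_ix_j}(b,\ell;t,r)$ ($b,t$ bottom/top, $\ell,r$ left/right states). $Z_m$ is symmetric in its arguments. *)

(* Defs.v *)
From mathcomp Require Import all_boot all_order all_algebra.
From mathcomp Require Import reals complex.

Set Implicit Arguments.
Unset Strict Implicit.
Unset Printing Implicit Defensive.

Import GRing.Theory.

Local Open Scope ring_scope.

(* Edge states are booleans, [true] standing for 1 and [false] for 0. *)

(* Arguments: incoming bottom, incoming left, outgoing top, outgoing right. *)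
Definition bulk_weight (F : fieldType) (q z : F) (i j k l : bool) : F :=
  match i, j, k, l with
  | false, false, false, false => 1
  | true, true, true, true => 1
  | true, false, true, false => q * (1 - z) / (1 - q * z)
  | true, false, false, true => (1 - q) / (1 - q * z)
  | false, true, false, true => (1 - z) / (1 - q * z)
  | false, true, true, false => z * (1 - q) / (1 - q * z)
  | _, _, _, _ => 0
  end.

Definition hfun (F : fieldType) (a c x : F) : F :=
  a * c * (1 - x ^+ 2) / ((a - x) * (c - x)).

(* Arguments: incoming (from below), outgoing (to the right). *)
Definition boundary_weight (F : fieldType) (a c x : F) (s s' : bool) : F :=
  match s, s' with
  | false, false => 1 - hfun a c x
  | false, true => hfun a c x
  | true, false => - hfun a c x / (a * c)
  | true, true => 1 + hfun a c x / (a * c)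
  end.

(* Lines and rows are numbered 0, ..., m-1.  The state of the lattice is given
   by two functions [v] and [w]:
   - [v (i, k)], for 0 <= k <= i, is the state of the segment of vertical line
     [i] between rows [k-1] and [k]; [k = 0] is the bottom entrance of the line
     and [k = i] is the segment that reaches its boundary vertex;
   - [w (j, k)], for j < k <= m, is the state of the segment of row [j] between
     vertical lines [k-1] and [k]; [k = j+1] is the segment leaving the boundary
     vertex and [k = m] is the exit on the right.
   The two predicates below force state 0 on the entrances and exits, and on the
   indices that label no segment (so that each state is counted once). *)
Definition vertical_state (m : nat) (v : {ffun 'I_m * 'I_m.+1 -> bool}) : bool :=
  [forall i : 'I_m, forall k : 'I_m.+1, v (i, k) ==> (0 < k <= i)%N].

Definition horizontal_state (m : nat) (w : {ffun 'I_m * 'I_m.+1 -> bool}) : bool :=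
  [forall j : 'I_m, forall k : 'I_m.+1, w (j, k) ==> (j < k < m)%N].

Definition state_weight (F : fieldType) (q a c : F) (m : nat) (x : 'I_m -> F)
    (v w : {ffun 'I_m * 'I_m.+1 -> bool}) : F :=
  (\prod_(i < m) boundary_weight a c (x i) (v (i, inord i)) (w (i, inord i.+1)))
  * \prod_(i < m) \prod_(j < m | (j < i)%N)
      bulk_weight q (x i * x j)
        (v (i, inord j)) (w (j, inord i)) (v (i, inord j.+1)) (w (j, inord i.+1)).

Definition Z (F : fieldType) (q a c : F) (m : nat) (x : 'I_m -> F) : F :=
  \sum_(v : {ffun 'I_m * 'I_m.+1 -> bool} | vertical_state v)
    \sum_(w : {ffun 'I_m * 'I_m.+1 -> bool} | horizontal_state w)
      state_weight q a c x v w.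

(* For a = 1, c = -1 the function h is 1 wherever it is defined, i.e. away from
   x = 1 and x = -1.  At these two points [hfun 1 (-1)] is 0 by the convention
   on division by zero. *)
Definition ZK (F : fieldType) (q : F) (m : nat) (x : 'I_m -> F) : F :=
  Z q 1 (-1) x.

Definition Hprod (F : fieldType) (a c : F) (m : nat) (x : 'I_m -> F) : F :=
  \prod_(i < m) (1 - hfun a c (x i)).

(* The alphabet (x_i)_{i in S}, listed by increasing i. *)
Definition subalphabet (F : fieldType) (m : nat) (x : 'I_m -> F)
    (S : {set 'I_m}) : 'I_#|S| -> F :=
  fun k => x (enum_val k).
Arguments subalphabet {F m} x S _.

(* Main.v *)
(* Removing the denominators of the weights turns the partition function into a
   polynomial [Znum], symmetric in the alphabet by the Yang-Baxter and reflection
   equations.  As a function of one letter [X], the others forming [s], both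
   sides times [\prod_(y <- s) (y - X)] have degree at most [2 |s| + 2], so it
   suffices to compare them at [2 |s| + 3] points: at [X = 0] both vanish; at
   [X = 1] and [X = -1] the boundary matrix is scalar and the line of [X]
   decouples; at [X = 1 / y] the lines of [X] and [y] annihilate; at [X = y] the
   subsets containing exactly one of the two letters cancel in pairs. *)
Require Import Defs.
From mathcomp Require Import all_boot all_order all_algebra.
From mathcomp Require Import boolp reals complex ring zify.

Set Implicit Arguments.
Unset Strict Implicit.
Unset Printing Implicit Defensive.

Import GRing.Theory.

Local Open Scope ring_scope.

(** * Symmetry *)

(** [Z] and Z^K are both values of [Znum], at two choices of [(b, t)]. At [(1, 0)] the boundary
    matrix is [dcoef x] times the flip of the two states, and its zero diagonal decides which
    subsets survive at the special points: a letter 1 or -1 can only lie outside the subset, and an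
    inverse pair [x], [y] yields the summand [kcoef b t x * kcoef b t y] from outside and
    [b * (dcoef x * dcoef y)] from inside, which together are the scalar of [Znum_inverse_pair]. The
    comparison is a strong induction on the number of letters, since at every node outside [s] both
    sides reduce to a smaller alphabet. The degree comes from a quadratic boundary weight, one
    affine weight per crossing and the clearing product. The obstacle is that the nodes collide as
    soon as [s] contains 0, 1, -1 or an inverse pair. But then the alphabet reduces directly, with
    no interpolation, so interpolation is only needed when the nodes are distinct. *)

Definition bulk_num (R : comNzRingType) (q z : R) (i j k l : bool) : R :=
  match i, j, k, l with
  | false, false, false, false => 1 - q * z
  | true, true, true, true => 1 - q * z
  | true, false, true, false => q * (1 - z)
  | true, false, false, true => 1 - q
  | false, true, false, true => 1 - z
  | false, true, true, false => z * (1 - q)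
  | _, _, _, _ => 0
  end.

Definition dcoef (R : comNzRingType) (x : R) : R := 1 - x ^+ 2.

Definition kcoef (R : comNzRingType) (b t x : R) : R := (1 - b) * x ^+ 2 + t * x.

(* [boundary_weight a c] is proportional to this matrix for [b = - 1 / (a c)] and
   [t = - (a + c) / (a c)], and the boundary weight of [ZK] for [b = 1], [t = 0]. *)
Definition boundary_num (R : comNzRingType) (b t x : R) (s s' : bool) : R :=
  match s, s' with
  | false, false => kcoef b t x
  | false, true => dcoef x
  | true, false => b * dcoef x
  | true, true => kcoef b t x + (1 - b) * dcoef x
  end.

(* Row [x], entered in state [w], crosses the vertical lines [s] with bottom
   states [bs] and exits in state 0; [f] weighs the states above the row. *)
Fixpoint row_sum (R : comNzRingType) (q x : R) (s : seq R) (w : bool)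
    (bs : seq bool) (f : seq bool -> R) : R :=
  match s, bs with
  | [::], [::] => if w then 0 else f [::]
  | y :: s', b :: bs' =>
      \sum_(p : bool * bool) bulk_num q (x * y) b w p.1 p.2 *
        row_sum q x s' p.2 bs' (fun ts => f (p.1 :: ts))
  | _, _ => 0
  end.

Fixpoint lattice_sum (R : comNzRingType) (q b t : R) (s : seq R)
    (bs : seq bool) : R :=
  match s, bs with
  | [::], [::] => 1
  | x :: s', b0 :: bs' =>
      \sum_(w : bool) boundary_num b t x b0 w *
        row_sum q x s' w bs' (lattice_sum q b t s')
  | _, _ => 0
  end.

Definition Znum (R : comNzRingType) (q b t : R) (s : seq R) : R :=
  lattice_sum q b t s (nseq (size s) false).

Lemma big_bool2 (R : nmodType) (f : bool * bool -> R) :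
  \sum_(p : bool * bool) f p =
  f (true, true) + f (true, false) + (f (false, true) + f (false, false)).
Proof.
rewrite (eq_bigr (fun p => f (p.1, p.2))); last by case.
by rewrite -(pair_bigA _ (fun i j => f (i, j))) /= !big_bool.
Qed.

Lemma eq_row_sum (R : comNzRingType) (q x : R) (s : seq R) (w : bool)
    (bs : seq bool) (f g : seq bool -> R) :
  f =1 g -> row_sum q x s w bs f = row_sum q x s w bs g.
Proof.
elim: s w bs f g => [|y s IH] w [|b bs] f g efg //=; first by rewrite efg.
by apply: eq_bigr => p _; congr (_ * _); apply: IH => ts.
Qed.

Lemma row_sum_sum (R : comNzRingType) (q x : R) (s : seq R) (w : bool)
    (bs : seq bool) (I : Type) (r : seq I) (c : I -> R) (f : I -> seq bool -> R) :
  row_sum q x s w bs (fun ts => \sum_(i <- r) c i * f i ts) =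
  \sum_(i <- r) c i * row_sum q x s w bs (f i).
Proof.
elim: s w bs f => [|y s IH] w [|b bs] f /=; try by rewrite big1 // => i _; rewrite mulr0.
  by case: w => //; rewrite big1 // => i _; rewrite mulr0.
under eq_bigr => p _ do rewrite (IH p.2 bs (fun i ts => f i (p.1 :: ts))) mulr_sumr.
rewrite exchange_big; apply: eq_bigr => i _; rewrite mulr_sumr.
by apply: eq_bigr => p _; rewrite mulrCA.
Qed.

Lemma row_sumZ (R : comNzRingType) (q x : R) (s : seq R) (w : bool)
    (bs : seq bool) (c : R) (f : seq bool -> R) :
  row_sum q x s w bs (fun ts => c * f ts) = c * row_sum q x s w bs f.
Proof.
elim: s w bs f => [|y s IH] w [|b bs] f /=; rewrite ?mulr0 //.
  by case: w; rewrite ?mulr0.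
rewrite mulr_sumr; apply: eq_bigr => p _.
by rewrite (IH p.2 bs (fun ts => f (p.1 :: ts))) mulrCA.
Qed.

(** Bulk vertices conserve the number of 1s, so a row entered empty above empty bottoms stays
    empty. *)
Lemma row_sum0 (R : comNzRingType) (q x : R) (s : seq R) (f : seq bool -> R) :
  row_sum q x s false (nseq (size s) false) f =
  \prod_(y <- s) (1 - q * (x * y)) * f (nseq (size s) false).
Proof.
elim: s f => [|y s IH] f /=; first by rewrite big_nil mul1r.
by rewrite big_bool2 /= !mul0r !add0r IH big_cons -mulrA.
Qed.

(* R-matrices intertwining two vertical lines, respectively two rows, with
   parameters [x] and [y]. *)
Definition vcross (R : comNzRingType) (q x y : R) (i j k l : bool) : R :=
  match i, j, k, l with
  | false, false, false, false => q * x - y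
  | true, true, true, true => q * x - y
  | true, false, true, false => (q - 1) * x
  | true, false, false, true => x - y
  | false, true, true, false => q * (x - y)
  | false, true, false, true => (q - 1) * y
  | _, _, _, _ => 0
  end.

Definition hcross (R : comNzRingType) (q x y : R) (i j k l : bool) : R :=
  match i, j, k, l with
  | false, false, false, false => q * x - y
  | true, true, true, true => q * x - y
  | true, false, true, false => (q - 1) * y
  | true, false, false, true => q * (x - y)
  | false, true, true, false => x - y
  | false, true, false, true => (q - 1) * x
  | _, _, _, _ => 0
  end.

(** The R-matrix [vcross] attached below lines [n] and [n.+1], counted from 0, of a lattice with
    weight [f]. *)
Fixpoint cross_at (R : comNzRingType) (q x y : R) (n : nat)
    (f : seq bool -> R) (bs : seq bool) : R :=
  match n, bs with
  | 0, b1 :: b2 :: bs' =>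
      \sum_(p : bool * bool) vcross q x y b1 b2 p.1 p.2 * f (p.1 :: p.2 :: bs')
  | n'.+1, b :: bs' => cross_at q x y n' (fun cs => f (b :: cs)) bs'
  | _, _ => 0
  end.

Lemma cross_at_sum (R : comNzRingType) (q x y : R) (n : nat) (bs : seq bool)
    (I : Type) (r : seq I) (c : I -> R) (f : I -> seq bool -> R) :
  cross_at q x y n (fun ts => \sum_(i <- r) c i * f i ts) bs =
  \sum_(i <- r) c i * cross_at q x y n (f i) bs.
Proof.
elim: n bs f => [|n IH] [|b bs] f /=; try by rewrite big1 // => i _; rewrite mulr0.
  case: bs => [|b2 bs]; first by rewrite big1 // => i _; rewrite mulr0.
  under eq_bigr => p _ do rewrite mulr_sumr.
  rewrite exchange_big; apply: eq_bigr => i _; rewrite mulr_sumr.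
  by apply: eq_bigr => p _; rewrite mulrCA.
exact: (IH bs (fun i cs => f i (b :: cs))).
Qed.

(** On empty entrances the R-matrix acts as a scalar; this turns the intertwining relation for
    [lattice_sum] into a symmetry of [Znum]. *)
Lemma cross_at0 (R : comNzRingType) (q x y : R) (n k : nat) (f : seq bool -> R) :
  cross_at q x y n f (nseq (n + k.+2) false) =
  (q * x - y) * f (nseq (n + k.+2) false).
Proof.
elim: n f => [|n IH] f /=; last by rewrite IH.
by rewrite big_bool2 /= !mul0r !add0r.
Qed.

(* Yang-Baxter equation for two vertical lines crossed by a row. *)
Lemma row_sum_cross (R : comNzRingType) (q x y z : R) (s1 s2 : seq R) (w : bool)
    (bs : seq bool) (f : seq bool -> R) :
  cross_at q x y (size s1) (fun cs => row_sum q z (s1 ++ x :: y :: s2) w cs f) bs =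
  row_sum q z (s1 ++ y :: x :: s2) w bs (cross_at q x y (size s1) f).
Proof.
elim: s1 w bs f => [|v s1 IH] w [|b bs] f //=.
  case: bs => [|b2 bs]; first by rewrite big1 // => p _; rewrite mulr0.
  under [RHS]eq_bigr => p _.
    under eq_bigr => p' _ do rewrite (row_sum_sum _ _ _ _ _ _
      (fun p'' => vcross q x y p.1 p'.1 p''.1 p''.2)
      (fun p'' ts => f (p''.1 :: p''.2 :: ts))).
    over.
  (* With everything to the right hidden in an arbitrary [G], the goal is the local Yang-Baxter
     equation, a polynomial identity for each of the eight incoming states. *)
  set G := fun t1 t2 r => row_sum q z s2 r bs (fun ts => f (t1 :: t2 :: ts)).
  under eq_bigr => p _ do under eq_bigr => p' _ do under eq_bigr => p'' _ do
    rewrite -/(G p'.1 p''.1 p''.2).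
  under [RHS]eq_bigr => p _ do under eq_bigr => p' _ do under eq_bigr => p'' _ do
    rewrite -/(G p''.1 p''.2 p'.2).
  move: G => G; rewrite !big_bool2 /=.
  by case: b; case: b2; case: w => /=; ring.
rewrite (cross_at_sum _ _ _ _ _ _ (fun p => bulk_num q (z * v) b w p.1 p.2)
  (fun p cs => row_sum q z (s1 ++ x :: y :: s2) p.2 cs (fun ts => f (p.1 :: ts)))).
by apply: eq_bigr => p _; rewrite IH.
Qed.

(* Yang-Baxter equation for two rows crossing the vertical lines [s]. *)
Lemma row_sum_exchange (R : comNzRingType) (q x y : R) (s : seq R) (r w : bool)
    (bs : seq bool) (f : seq bool -> R) :
  (q * x - y) * row_sum q y s r bs (fun ts => row_sum q x s w ts f) =
  \sum_(p : bool * bool) hcross q x y r w p.1 p.2 *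
    row_sum q x s p.1 bs (fun ts => row_sum q y s p.2 ts f).
Proof.
elim: s r w bs f => [|z s IH] r w [|b bs] f /=;
  try by rewrite ?mulr0 big1 // => p _; rewrite mulr0.
  (* Past the last column the R-matrix meets two exits in state 0, where its only nonzero entry is
     [q * x - y]: the scalar on the left. *)
  by rewrite big_bool2; case: r; case: w => /=; ring.
have E x' y' r' w' : \sum_p bulk_num q (x' * z) b r' p.1 p.2 *
    row_sum q x' s p.2 bs (fun ts => \sum_p0 bulk_num q (y' * z) p.1 w' p0.1 p0.2 *
      row_sum q y' s p0.2 ts (fun ts0 => f (p0.1 :: ts0))) =
  \sum_p \sum_p0 bulk_num q (x' * z) b r' p.1 p.2 * bulk_num q (y' * z) p.1 w' p0.1 p0.2 *
    row_sum q x' s p.2 bs (fun ts => row_sum q y' s p0.2 ts (fun ts0 => f (p0.1 :: ts0))).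
  apply: eq_bigr => p _.
  rewrite (row_sum_sum _ _ _ _ _ _ (fun p0 => bulk_num q (y' * z) p.1 w' p0.1 p0.2)
    (fun p0 ts => row_sum q y' s p0.2 ts (fun ts0 => f (p0.1 :: ts0)))).
  by rewrite mulr_sumr; apply: eq_bigr => p0 _; rewrite mulrA.
rewrite E [RHS](eq_bigr (fun p => hcross q x y r w p.1 p.2 *
  \sum_p1 \sum_p0 bulk_num q (x * z) b p.1 p1.1 p1.2 * bulk_num q (y * z) p1.1 p.2 p0.1 p0.2 *
    row_sum q x s p1.2 bs (fun ts => row_sum q y s p0.2 ts (fun ts0 => f (p0.1 :: ts0)))));
  last by move=> p _; congr (_ * _); exact: E.
rewrite mulr_sumr; under [LHS]eq_bigr => p _.
  rewrite mulr_sumr; under eq_bigr => p0 _ do rewrite mulrCA IH.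
  over.
set G := fun t r1 r2 =>
  row_sum q x s r1 bs (fun ts => row_sum q y s r2 ts (fun ts0 => f (t :: ts0))).
under eq_bigr => p _ do under eq_bigr => p' _ do under eq_bigr => p'' _ do
  rewrite -/(G p'.1 p''.1 p''.2).
under [RHS]eq_bigr => p _ do under eq_bigr => p' _ do under eq_bigr => p'' _ do
  rewrite -/(G p''.1 p'.2 p''.2).
move: G {E} => G; rewrite !big_bool2 /=.
by case: b; case: r; case: w => /=; ring.
Qed.

(** Reflection equation: the crossing below the first two lines passes through their two boundary
    vertices and mutual crossing, becoming [hcross] between the two rows, which [row_sum_exchange]
    pushes out to the right. *)
Lemma lattice_sum_swap0 (R : comNzRingType) (q b t x y : R) (s : seq R) (bs : seq bool) :
  cross_at q x y 0 (lattice_sum q b t (x :: y :: s)) bs =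
  (q * x - y) * lattice_sum q b t (y :: x :: s) bs.
Proof.
case: bs => [|b1 [|b2 bs]]; rewrite /= ?mulr0 //.
  by rewrite big1 ?mulr0 // => w _; rewrite mulr0.
have E x' y' c1 c2 : \sum_w boundary_num b t x' c1 w *
   (\sum_p bulk_num q (x' * y') c2 w p.1 p.2 *
    row_sum q x' s p.2 bs (fun ts => \sum_w' boundary_num b t y' p.1 w' *
      row_sum q y' s w' ts (lattice_sum q b t s))) =
  \sum_w \sum_p \sum_w' boundary_num b t x' c1 w * bulk_num q (x' * y') c2 w p.1 p.2 *
    boundary_num b t y' p.1 w' *
    row_sum q x' s p.2 bs (fun ts => row_sum q y' s w' ts (lattice_sum q b t s)).
  apply: eq_bigr => w _; rewrite mulr_sumr; apply: eq_bigr => p _.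
  rewrite (row_sum_sum _ _ _ _ _ _ (fun w' => boundary_num b t y' p.1 w')
    (fun w' ts => row_sum q y' s w' ts (lattice_sum q b t s))).
  by rewrite !mulr_sumr; apply: eq_bigr => w' _; rewrite !mulrA.
under eq_bigr => p _ do rewrite E.
rewrite E !mulr_sumr; under [RHS]eq_bigr => w _.
  rewrite mulr_sumr; under eq_bigr => p _.
    rewrite mulr_sumr; under eq_bigr => w' _ do rewrite mulrCA row_sum_exchange.
    over.
  over.
set G := fun r1 r2 =>
  row_sum q x s r1 bs (fun ts => row_sum q y s r2 ts (lattice_sum q b t s)).
under eq_bigr => p _ do under eq_bigr => w _ do under eq_bigr => p' _ do
  under eq_bigr => w' _ do rewrite -/(G p'.2 w').
under [RHS]eq_bigr => w _ do under eq_bigr => p _ do under eq_bigr => w' _ do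
  under eq_bigr => p' _ do rewrite -/(G p'.1 p'.2).
move: G {E} => G; rewrite !(big_bool2, big_bool) /=.
by case: b1; case: b2 => /=; rewrite /kcoef /dcoef; ring.
Qed.

(** The R-matrix rises through the rows of [s1] by the Yang-Baxter equation until its two lines come
    first, where the reflection equation applies. *)
Lemma lattice_sum_swap (R : comNzRingType) (q b t x y : R) (s1 s2 : seq R) (bs : seq bool) :
  cross_at q x y (size s1) (lattice_sum q b t (s1 ++ x :: y :: s2)) bs =
  (q * x - y) * lattice_sum q b t (s1 ++ y :: x :: s2) bs.
Proof.
elim: s1 bs => [|z s1 IH] [|b0 bs] /=; rewrite ?mulr0 //; first exact: (lattice_sum_swap0 q b t x y s2 (b0 :: bs)).
rewrite (cross_at_sum _ _ _ _ _ _ (fun w => boundary_num b t z b0 w)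
  (fun w cs => row_sum q z (s1 ++ x :: y :: s2) w cs (lattice_sum q b t (s1 ++ x :: y :: s2)))).
rewrite mulr_sumr; apply: eq_bigr => w _.
rewrite row_sum_cross (eq_row_sum _ _ _ _ _ IH) row_sumZ; ring.
Qed.

Lemma Znum_swap (R : comNzRingType) (q b t x y : R) (s1 s2 : seq R) :
  (q * x - y) * Znum q b t (s1 ++ x :: y :: s2) =
  (q * x - y) * Znum q b t (s1 ++ y :: x :: s2).
Proof.
by rewrite /Znum -lattice_sum_swap !size_cat /= cross_at0.
Qed.

Lemma rmorph_row_sum (R S : comNzRingType) (h : {rmorphism R -> S}) (q x : R)
    (s : seq R) (w : bool) (bs : seq bool) (f : seq bool -> R) :
  h (row_sum q x s w bs f) = row_sum (h q) (h x) (map h s) w bs (h \o f).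
Proof.
elim: s w bs f => [|y s IH] w [|b bs] f /=; rewrite ?rmorph0 //.
  by case: w; rewrite ?rmorph0.
rewrite rmorph_sum; apply: eq_bigr => p _.
rewrite rmorphM IH; congr (_ * _).
by case: b; case: w; case: p => -[] [];
  rewrite /= ?(rmorphM, rmorphB, rmorph1, rmorph0).
Qed.

Lemma rmorph_lattice_sum (R S : comNzRingType) (h : {rmorphism R -> S}) (q b t : R)
    (s : seq R) (bs : seq bool) :
  h (lattice_sum q b t s bs) = lattice_sum (h q) (h b) (h t) (map h s) bs.
Proof.
elim: s bs => [|x s IH] [|b0 bs] /=; rewrite ?rmorph0 ?rmorph1 //.
rewrite rmorph_sum; apply: eq_bigr => w _.
rewrite rmorphM rmorph_row_sum (eq_row_sum _ _ _ _ _ IH); congr (_ * _).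
by case: b0; case: w; rewrite /= /kcoef /dcoef;
  rewrite ?(rmorphM, rmorphD, rmorphN, rmorphXn, rmorph1).
Qed.

(* Over {poly F} with [q] replaced by the indeterminate, the common factor of
   [Znum_swap] is nonzero and can be cancelled. *)
Lemma Znum_perm (F : fieldType) (q b t : F) (s s' : seq F) :
  perm_eq s s' -> Znum q b t s = Znum q b t s'.
Proof.
have swap s1 s2 x y : Znum q b t (s1 ++ x :: y :: s2) = Znum q b t (s1 ++ y :: x :: s2).
  case: (eqVneq x y) => [-> //|nxy].
  have hornq u : Znum q b t u = (Znum 'X b%:P t%:P (map polyC u)).[q].
    rewrite -[RHS]/(horner_eval q _) /Znum rmorph_lattice_sum size_map -map_comp /=.
    rewrite /horner_eval hornerX !hornerC; congr lattice_sum.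
    by rewrite -[LHS]map_id; apply: eq_map => z /=; rewrite hornerC.
  rewrite !hornq; congr (_.[q]); rewrite !map_cat /=.
  have nz : 'X * x%:P - y%:P != 0 :> {poly F}.
    apply: contra nxy => /eqP e.
    have := congr1 (coefp 1) e; have := congr1 (coefp 0) e.
    rewrite /= !coefB !coefC !coefXM !coefC /= !sub0r subr0 => /eqP.
    by rewrite oppr_eq0 => /eqP -> ->.
  by apply: (mulfI nz); rewrite Znum_swap.
have move_front p s1 s2 x :
    Znum q b t (p ++ s1 ++ x :: s2) = Znum q b t (p ++ x :: s1 ++ s2).
  elim/last_ind: s1 s2 => [|s1 z IH] s2 //.
  by rewrite !cat_rcons catA swap -catA IH.
suff H p u u' : perm_eq u u' -> Znum q b t (p ++ u) = Znum q b t (p ++ u').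
  exact: (H [::]).
elim: u u' p => [|x u IH] u' p; first by rewrite perm_sym => /perm_nilP ->.
move=> puu'; have xu' : x \in u' by rewrite -(perm_mem puu') mem_head.
case/splitPr: xu' puu' => u1 u2 puu'.
rewrite move_front -!cat_rcons; apply: IH.
by rewrite -(perm_cons x) (perm_trans puu') // -[x :: u2]cat1s perm_catCA.
Qed.

(** * Special values and the subset sum *)

(** Splits on the state leaving the first boundary vertex. The letter [x] occurs only in this vertex
    and in the first row, which gives both the degree bound and the special values. *)
Lemma Znum_cons (R : comNzRingType) (q b t x : R) (s : seq R) :
  Znum q b t (x :: s) =
  kcoef b t x * (\prod_(y <- s) (1 - q * (x * y)) * Znum q b t s) +
  dcoef x * row_sum q x s true (nseq (size s) false) (lattice_sum q b t s).
Proof. by rewrite /Znum /= big_bool /= row_sum0 addrC. Qed.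

Lemma Znum_dcoef0 (R : comNzRingType) (q b t x : R) (s : seq R) :
  dcoef x = 0 ->
  Znum q b t (x :: s) = kcoef b t x * (\prod_(y <- s) (1 - q * (x * y)) * Znum q b t s).
Proof. by move=> d0; rewrite Znum_cons d0 mul0r addr0. Qed.

(** At parameter 0 the weight of turning from the row into a vertical line vanishes, so a 1 that
    enters the row can never leave it before the exit. *)
Lemma row_sum_param0 (R : comNzRingType) (q : R) (s : seq R) (f : seq bool -> R) :
  row_sum q 0 s true (nseq (size s) false) f = 0.
Proof.
elim: s f => [|y s IH] f //=.
by rewrite big_bool2 /= !mul0r IH mulr0 !addr0.
Qed.

Lemma Znum0 (R : comNzRingType) (q b t : R) (s : seq R) : Znum q b t (0 :: s) = 0.
Proof.
rewrite Znum_cons row_sum_param0 mulr0 addr0 /kcoef expr0n /= !mulr0 addr0.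
by rewrite mul0r.
Qed.

(* At [x * y = 1] the crossing of the first two lines always turns, so that the
   boundary vertices compose to [K_x K_y], a scalar matrix. *)
Lemma Znum_inverse_pair (R : comNzRingType) (q b t x y : R) (s : seq R) :
  x * y = 1 ->
  Znum q b t (x :: y :: s) =
  (1 - q) * (kcoef b t x * kcoef b t y + b * (dcoef x * dcoef y)) *
  (\prod_(z <- s) (1 - q * (x * z)) * \prod_(z <- s) (1 - q * (y * z))) *
  Znum q b t s.
Proof.
move=> xy1; rewrite {1}/Znum /= !big_bool !big_bool2 /= xy1 !row_sum0 /= !big_bool /=.
rewrite !row_sum0 -/(Znum q b t s).
set r := row_sum q y s true _ _.
(* This is the (0;1) entry of the product of the two boundary matrices. It multiplies the only
   contribution [r] in which row [y] is entered in state 1. *)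
have kd : kcoef b t x * dcoef y + dcoef x * (kcoef b t y + (1 - b) * dcoef y) =
    (x * y - 1) * ((b - 1) * (x * y + 1) - t * (x + y)).
  by rewrite /kcoef /dcoef; ring.
rewrite xy1 subrr mul0r in kd.
move: (\prod_(z <- s) (1 - q * (x * z))) (\prod_(z <- s) (1 - q * (y * z))) => P Q.
move: (dcoef x) (dcoef y) (kcoef b t x) (kcoef b t y) kd => dx dy kx ky kd.
apply/eqP; rewrite -subr_eq0; apply/eqP.
by transitivity ((1 - q) * P * r * (kx * dy + dx * (ky + (1 - b) * dy)));
  [ring | rewrite kd mulr0].
Qed.

(** Subsets with their complements, as lists: this allows recursion on the first letter and
    reordering of the alphabet, both awkward with subsets of an ordinal type. *)
Fixpoint splits (T : Type) (s : seq T) : seq (seq T * seq T) :=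
  if s is x :: s' then
    [seq (x :: p.1, p.2) | p <- splits s'] ++ [seq (p.1, x :: p.2) | p <- splits s']
  else [:: ([::], [::])].

Lemma big_splits_cons (R : nmodType) (T : Type) (x : T) (s : seq T)
    (f : seq T -> seq T -> R) :
  \sum_(p <- splits (x :: s)) f p.1 p.2 =
  \sum_(p <- splits s) (f (x :: p.1) p.2 + f p.1 (x :: p.2)).
Proof. by rewrite /= big_cat !big_map big_split. Qed.

Lemma perm_splits (T : eqType) (s : seq T) (p : seq T * seq T) :
  p \in splits s -> perm_eq (p.1 ++ p.2) s.
Proof.
elim: s p => [|x s IH] p /=; first by rewrite inE => /eqP ->.
rewrite mem_cat => /orP[] /mapP[p' /IH pp' ->] /=; first by rewrite perm_cons.
by rewrite -cat1s perm_catCA /= perm_cons.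
Qed.

Lemma big_splits_perm (R : nmodType) (T : eqType) (s s' : seq T)
    (f : seq T -> seq T -> R) :
  (forall A A' B B', perm_eq A A' -> perm_eq B B' -> f A B = f A' B') ->
  perm_eq s s' ->
  \sum_(p <- splits s) f p.1 p.2 = \sum_(p <- splits s') f p.1 p.2.
Proof.
have cons_inv x (g : seq T -> seq T -> R) :
    (forall A A' B B', perm_eq A A' -> perm_eq B B' -> g A B = g A' B') ->
  forall A A' B B', perm_eq A A' -> perm_eq B B' ->
    g (x :: A) B + g A (x :: B) = g (x :: A') B' + g A' (x :: B').
  by move=> gP A A' B B' pA pB; congr (_ + _); apply: gP; rewrite ?perm_cons.
have swap2 x y (u : seq T) : perm_eq (x :: y :: u) (y :: x :: u).
  by rewrite -[x :: _]cat1s -[y :: u]cat1s perm_catCA.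
have move_front x s1 s2 (g : seq T -> seq T -> R) :
    (forall A A' B B', perm_eq A A' -> perm_eq B B' -> g A B = g A' B') ->
    \sum_(p <- splits (s1 ++ x :: s2)) g p.1 p.2 =
    \sum_(p <- splits (x :: s1 ++ s2)) g p.1 p.2.
  elim: s1 g => [|y s1 IH] g gP //=.
  rewrite (big_splits_cons y) (IH (fun A B => g (y :: A) B + g A (y :: B)));
    last exact: cons_inv.
  rewrite (big_splits_cons x _ (fun A B => g (y :: A) B + g A (y :: B))).
  rewrite [RHS](big_splits_cons x (y :: s1 ++ s2)).
  rewrite (big_splits_cons y _ (fun A B => g (x :: A) B + g A (x :: B))).
  apply: eq_bigr => p _; rewrite addrACA.
  by congr (_ + _ + (_ + _)); apply: gP; rewrite // swap2.
elim: s s' f => [|x s IH] s' f fP; first by rewrite perm_sym => /perm_nilP ->.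
move=> pss'; have xs' : x \in s' by rewrite -(perm_mem pss') mem_head.
case/splitPr: xs' pss' => s1 s2 pss'.
rewrite move_front // !big_splits_cons.
apply: (IH _ (fun A B => f (x :: A) B + f A (x :: B))); first exact: cons_inv.
by rewrite -(perm_cons x) (perm_trans pss') // -[x :: s2]cat1s perm_catCA.
Qed.

(** The common denominator of the bulk weights of the lattice. *)
Fixpoint pair_prod (R : comNzRingType) (q : R) (s : seq R) : R :=
  if s is x :: s' then \prod_(y <- s') (1 - q * (x * y)) * pair_prod q s' else 1.

Lemma pair_prod_perm (R : comNzRingType) (q : R) (s s' : seq R) :
  perm_eq s s' -> pair_prod q s = pair_prod q s'.
Proof.
elim: s s' => [|x s IH] s'; first by rewrite perm_sym => /perm_nilP ->.
move=> pss'; have xs' : x \in s' by rewrite -(perm_mem pss') mem_head.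
case/splitPr: xs' pss' => s1 s2 pss'.
have pc : perm_eq s (s1 ++ s2).
  by rewrite -(perm_cons x) (perm_trans pss') // -[x :: s2]cat1s perm_catCA.
rewrite /= (perm_big _ pc) (IH _ pc) /=.
elim: s1 {pss' pc} => [|y s1 IH1] //=.
rewrite -IH1 !(big_cons, big_cat) /= [y * x]mulrC.
by ring.
Qed.

(** The last factor is the share of [pair_prod] that belongs to a pair separated by the subset. *)
Definition cross_factor (F : fieldType) (q x y : F) : F :=
  (1 - x * y) / (x - y) * (1 - q * (x * y)).

(** The term of the expansion for the subset [A], cleared of the denominators of the weights: of the
    factors [1 - h] only those on [B] survive, and the numerators of [h] on [A] are absorbed by
    [Znum q 1 0 A]. *)
Definition split_term (F : fieldType) (q b t : F) (A B : seq F) : F :=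
  if odd (size A) then 0 else
  b ^+ (size A)./2 * \prod_(y <- B) kcoef b t y *
  \prod_(x <- A) \prod_(y <- B) cross_factor q x y *
  pair_prod q B * Znum q 1 0 A.

Lemma split_term_perm (F : fieldType) (q b t : F) (A A' B B' : seq F) :
  perm_eq A A' -> perm_eq B B' -> split_term q b t A B = split_term q b t A' B'.
Proof.
move=> pA pB; rewrite /split_term (perm_size pA) (Znum_perm _ _ _ pA).
rewrite (pair_prod_perm _ pB) (perm_big _ pB) (perm_big _ pA) /=.
case: ifP => // _; congr (_ * _ * _ * _).
by apply: eq_bigr => x _; exact: perm_big.
Qed.

Definition split_sum (F : fieldType) (q b t : F) (s : seq F) : F :=
  \sum_(p <- splits s) split_term q b t p.1 p.2.

Lemma split_sum_perm (F : fieldType) (q b t : F) (s s' : seq F) :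
  perm_eq s s' -> split_sum q b t s = split_sum q b t s'.
Proof. by apply: big_splits_perm; exact: split_term_perm. Qed.

Lemma kcoef10 (R : comNzRingType) (x : R) : kcoef 1 0 x = 0.
Proof. by rewrite /kcoef; ring. Qed.

Lemma split_sum0 (F : fieldType) (q b t : F) (s : seq F) : split_sum q b t (0 :: s) = 0.
Proof.
rewrite /split_sum big_splits_cons big1 // => p _.
rewrite /split_term Znum0 mulr0 if_same add0r big_cons.
have -> : kcoef b t 0 = 0 by rewrite /kcoef; ring.
by rewrite !(mul0r, mulr0) if_same.
Qed.

(** Terms with [x] in the subset vanish by [kcoef10]. In the others, [x ^+ 2 = 1] gives
    [(1 - z * x) / (z - x) = - x], and the number of such factors is even. *)
Lemma split_sum_dcoef0 (F : fieldType) (q b t x : F) (s : seq F) :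
  dcoef x = 0 -> x \notin s ->
  split_sum q b t (x :: s) =
  kcoef b t x * (\prod_(y <- s) (1 - q * (x * y)) * split_sum q b t s).
Proof.
move=> d0 xs; rewrite /split_sum big_splits_cons mulrA mulr_sumr.
rewrite big_seq [RHS]big_seq; apply: eq_bigr => p /perm_splits pp.
rewrite /split_term /= Znum_dcoef0 // kcoef10 mul0r mulr0 if_same add0r.
rewrite -(perm_big _ pp) big_cat /= big_cons.
case: ifP => oA; first by rewrite mulr0.
have x2 : x ^+ 2 = 1 by apply/esym/eqP; rewrite -subr_eq0 -/(dcoef x) d0.
have -> : \prod_(z <- p.1) \prod_(y <- x :: p.2) cross_factor q z y =
    \prod_(z <- p.1) (1 - q * (x * z)) * \prod_(z <- p.1) \prod_(y <- p.2) cross_factor q z y.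
  under eq_bigr => z _ do rewrite big_cons.
  rewrite big_split /=; congr (_ * _).
  have -> : \prod_(z <- p.1) cross_factor q z x =
      \prod_(z <- p.1) (- x) * \prod_(z <- p.1) (1 - q * (x * z)).
    rewrite -big_split /= big_seq [RHS]big_seq; apply: eq_bigr => z zp.
    rewrite /cross_factor [x * z]mulrC; congr (_ * _).
    have zx : z - x != 0.
      rewrite subr_eq0; apply: contraNneq xs => <-.
      by rewrite -(perm_mem pp) mem_cat zp.
    by apply: (mulIf zx); rewrite mulfVK // -x2; ring.
  rewrite big_const_seq count_predT iter_mulr mulr1.
  by rewrite exprNn -signr_odd oA -[size _]odd_double_half oA -mul2n exprM x2 expr1n !mul1r.
by ring.
Qed.

(** A subset separating [x] from [y] carries the factor [1 - x * y = 0]. When both lie on one side,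
    their rational factors against any letter on the other side multiply to 1. *)
Lemma split_sum_inverse_pair (F : fieldType) (q b t x y : F) (s : seq F) :
  x * y = 1 -> x \notin s -> y \notin s ->
  split_sum q b t (x :: y :: s) =
  (1 - q) * (kcoef b t x * kcoef b t y + b * (dcoef x * dcoef y)) *
  (\prod_(z <- s) (1 - q * (x * z)) * \prod_(z <- s) (1 - q * (y * z))) *
  split_sum q b t s.
Proof.
move=> xy1 xs ys; rewrite /split_sum big_splits_cons.
rewrite (big_splits_cons y s (fun A B => split_term q b t (x :: A) B + split_term q b t A (x :: B))).
rewrite mulr_sumr big_seq [RHS]big_seq; apply: eq_bigr => p /perm_splits pp.
have xyA A B : split_term q b t (x :: A) (y :: B) = 0.
  by rewrite /split_term !big_cons /cross_factor xy1 subrr !(mul0r, mulr0) if_same.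
have yxA A B : split_term q b t (y :: A) (x :: B) = 0.
  by rewrite /split_term !big_cons /cross_factor [y * x]mulrC xy1 subrr !(mul0r, mulr0) if_same.
rewrite xyA yxA addr0 add0r /split_term /= negbK.
rewrite -!(perm_big _ pp) !big_cat /=.
case: ifP => oA; first by rewrite !mulr0 addr0.
rewrite Znum_inverse_pair // !kcoef10 mulr0 add0r mul1r.
have E z : z \in s -> (1 - x * z) / (x - z) * ((1 - y * z) / (y - z)) = 1.
  move=> zs; have xz : x - z != 0 by rewrite subr_eq0; apply: contraNneq xs => ->.
  have yz : y - z != 0 by rewrite subr_eq0; apply: contraNneq ys => ->.
  rewrite mulrACA -invfM; apply: (mulIf (mulf_neq0 xz yz)).
  rewrite mulfVK ?mulf_neq0 // mul1r.
  by transitivity ((x - z) * (y - z) + (1 - x * y) * (1 - z ^+ 2));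
    [ring | rewrite xy1 subrr mul0r addr0].
have -> : \prod_(z <- x :: y :: p.1) \prod_(y0 <- p.2) cross_factor q z y0 =
   \prod_(z <- p.2) (1 - q * (x * z)) * \prod_(z <- p.2) (1 - q * (y * z)) *
   \prod_(z <- p.1) \prod_(y0 <- p.2) cross_factor q z y0.
  rewrite !big_cons mulrA; congr (_ * _).
  rewrite -!big_split /= big_seq [RHS]big_seq; apply: eq_bigr => z zp.
  transitivity ((1 - x * z) / (x - z) * ((1 - y * z) / (y - z)) *
    ((1 - q * (x * z)) * (1 - q * (y * z)))); first by rewrite /cross_factor; ring.
  by rewrite E ?mul1r // -(perm_mem pp) mem_cat zp orbT.
have -> : \prod_(z <- p.1) \prod_(y0 <- x :: y :: p.2) cross_factor q z y0 =
   \prod_(z <- p.1) (1 - q * (x * z)) * \prod_(z <- p.1) (1 - q * (y * z)) *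
   \prod_(z <- p.1) \prod_(y0 <- p.2) cross_factor q z y0.
  under eq_bigr => z _ do rewrite !big_cons mulrA.
  rewrite big_split /=; congr (_ * _).
  rewrite -!big_split /= big_seq [RHS]big_seq; apply: eq_bigr => z zp.
  transitivity ((1 - x * z) / (x - z) * ((1 - y * z) / (y - z)) *
    ((1 - q * (x * z)) * (1 - q * (y * z)))).
    rewrite /cross_factor -[z - x]opprB -[z - y]opprB !invrN; ring.
  by rewrite E ?mul1r // -(perm_mem pp) mem_cat zp.
rewrite !big_cons xy1 mulr1 exprS.
by ring.
Qed.

(** * Interpolation *)

(** Degree bounds are stated for functions on [F], so that lattice sums need not be rebuilt over
    [{poly F}]. *)
Definition poly_fun (F : fieldType) (n : nat) (g : F -> F) : Prop :=
  exists2 p : {poly F}, (size p <= n.+1)%N & forall x, g x = p.[x].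

Lemma eq_poly_fun (F : fieldType) (n : nat) (g h : F -> F) :
  g =1 h -> poly_fun n g -> poly_fun n h.
Proof. by move=> gh [p sp gp]; exists p => // x; rewrite -gh. Qed.

Lemma poly_funW (F : fieldType) (m n : nat) (g : F -> F) :
  (m <= n)%N -> poly_fun m g -> poly_fun n g.
Proof. by move=> mn [p sp gp]; exists p => //; apply: leq_trans sp _. Qed.

Lemma poly_funC (F : fieldType) (c : F) : poly_fun 0 (fun=> c).
Proof. by exists c%:P => [|x]; [exact: size_polyC_leq1 | rewrite hornerC]. Qed.

Lemma poly_funX (F : fieldType) : poly_fun 1 (@id F).
Proof. by exists 'X => [|x]; [rewrite size_polyX | rewrite hornerX]. Qed.

Lemma poly_funD (F : fieldType) (n : nat) (g h : F -> F) :
  poly_fun n g -> poly_fun n h -> poly_fun n (fun x => g x + h x).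
Proof.
move=> [p sp gp] [r sr hr]; exists (p + r) => [|x]; last by rewrite hornerD gp hr.
by rewrite (leq_trans (size_polyD _ _)) // geq_max sp.
Qed.

Lemma poly_funM (F : fieldType) (m n : nat) (g h : F -> F) :
  poly_fun m g -> poly_fun n h -> poly_fun (m + n) (fun x => g x * h x).
Proof.
move=> [p sp gp] [r sr hr]; exists (p * r) => [|x]; last by rewrite hornerM gp hr.
apply: leq_trans (size_polyMleq _ _) _; lia.
Qed.

Lemma poly_funZ (F : fieldType) (n : nat) (c : F) (h : F -> F) :
  poly_fun n h -> poly_fun n (fun x => c * h x).
Proof. exact: poly_funM (poly_funC c). Qed.

Lemma poly_fun_affine (F : fieldType) (c d : F) : poly_fun 1 (fun x => c + d * x).
Proof.
apply: poly_funD; first exact: poly_funW (poly_funC c).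
exact: poly_funZ (poly_funX F).
Qed.

Lemma poly_fun_sum (F : fieldType) (I : Type) (r : seq I) (n : nat) (g : I -> F -> F) :
  (forall i, poly_fun n (g i)) -> poly_fun n (fun x => \sum_(i <- r) g i x).
Proof.
move=> gP; elim: r => [|i r IH].
  apply: (@eq_poly_fun _ _ (fun=> 0)); first by move=> x; rewrite big_nil.
  exact: poly_funW (poly_funC 0).
apply: (@eq_poly_fun _ _ (fun x => g i x + \sum_(j <- r) g j x)).
  by move=> x; rewrite big_cons.
exact: poly_funD.
Qed.

Lemma poly_fun_prod (F : fieldType) (I : Type) (r : seq I) (n : nat) (g : I -> F -> F) :
  (forall i, poly_fun n (g i)) -> poly_fun (size r * n) (fun x => \prod_(i <- r) g i x).
Proof.
move=> gP; elim: r => [|i r IH].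
  by apply: (@eq_poly_fun _ _ (fun=> 1)) (poly_funC 1) => x; rewrite big_nil.
apply: (@eq_poly_fun _ _ (fun x => g i x * \prod_(j <- r) g j x)).
  by move=> x; rewrite big_cons.
by rewrite mulSn; apply: poly_funM.
Qed.

Lemma poly_fun_row_sum (F : fieldType) (q : F) (s : seq F) (w : bool)
    (bs : seq bool) (f : seq bool -> F) :
  poly_fun (size s) (fun x => row_sum q x s w bs f).
Proof.
elim: s w bs f => [|y s IH] w [|b bs] f; try by apply: poly_funW (poly_funC 0).
  by case: w; exact: poly_funC.
apply: poly_fun_sum => p; rewrite -[size _]add1n; apply: poly_funM => //.
have C c : poly_fun 1 (fun=> c) by exact: poly_funW (poly_funC c).
case: b; case: w; case: p => -[] [] //=.
- by apply: eq_poly_fun (poly_fun_affine 1 (- (q * y))) => x; ring.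
- by apply: eq_poly_fun (poly_fun_affine q (- (q * y))) => x; ring.
- by apply: eq_poly_fun (poly_fun_affine 0 (y * (1 - q))) => x; ring.
- by apply: eq_poly_fun (poly_fun_affine 1 (- y)) => x; ring.
- by apply: eq_poly_fun (poly_fun_affine 1 (- (q * y))) => x; ring.
Qed.

Lemma poly_fun_kcoef (F : fieldType) (b t : F) : poly_fun 2 (kcoef b t).
Proof.
apply: (@eq_poly_fun _ _ (fun x => x * (t + (1 - b) * x))).
  by move=> x; rewrite /kcoef; ring.
exact: poly_funM (poly_funX F) (poly_fun_affine _ _).
Qed.

Lemma poly_fun_dcoef (F : fieldType) : poly_fun 2 (@dcoef F).
Proof.
apply: (@eq_poly_fun _ _ (fun x => (1 + 1 * x) * (1 + (-1) * x))).
  by move=> x; rewrite /dcoef; ring.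
exact: poly_funM (poly_fun_affine _ _) (poly_fun_affine _ _).
Qed.

(** Degree 2 from the boundary vertex of [x] and 1 from each crossing of its row. *)
Lemma poly_fun_Znum (F : fieldType) (q b t : F) (s : seq F) :
  poly_fun (2 + size s) (fun x => Znum q b t (x :: s)).
Proof.
apply: eq_poly_fun => [x|]; first by rewrite Znum_cons.
apply: poly_funD; (apply: poly_funM; first by
  [exact: poly_fun_kcoef | exact: poly_fun_dcoef]).
  apply: (@eq_poly_fun _ _ (fun x => Znum q b t s * \prod_(y <- s) (1 + - (q * y) * x))).
    move=> x; rewrite mulrC; congr (_ * _); apply: eq_bigr => y _; ring.
  apply: poly_funZ; rewrite -[size s]muln1; apply: poly_fun_prod => y.
  exact: poly_fun_affine.
exact: poly_fun_row_sum.
Qed.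

(* The two contributions of the head [x] to [split_sum], multiplied by
   [\prod_(y <- s) (y - x)] so as to be polynomial in [x]. *)
Definition cleared_left (F : fieldType) (q b t x : F) (A B : seq F) : F :=
  if odd (size A).+1 then 0 else
  b ^+ (size A).+1./2 * \prod_(y <- B) kcoef b t y *
  \prod_(z <- A) \prod_(y <- B) cross_factor q z y * pair_prod q B *
  (\prod_(y <- B) - ((1 - x * y) * (1 - q * (x * y))) *
   \prod_(z <- A) (z - x) * Znum q 1 0 (x :: A)).

Definition cleared_right (F : fieldType) (q b t x : F) (A B : seq F) : F :=
  if odd (size A) then 0 else
  b ^+ (size A)./2 * \prod_(y <- B) kcoef b t y *
  \prod_(z <- A) \prod_(y <- B) cross_factor q z y *
  pair_prod q B * Znum q 1 0 A *
  (kcoef b t x * \prod_(z <- A) ((1 - z * x) * (1 - q * (z * x))) *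
   \prod_(y <- B) ((y - x) * (1 - q * (x * y)))).

Definition cleared_sum (F : fieldType) (q b t x : F) (s : seq F) : F :=
  \sum_(p <- splits s) (cleared_left q b t x p.1 p.2 + cleared_right q b t x p.1 p.2).

Lemma cleared_sumE (F : fieldType) (q b t x : F) (s : seq F) :
  x \notin s ->
  split_sum q b t (x :: s) * \prod_(y <- s) (y - x) = cleared_sum q b t x s.
Proof.
move=> xs; rewrite /split_sum big_splits_cons mulr_suml.
rewrite big_seq [RHS]big_seq; apply: eq_bigr => p /perm_splits pp.
rewrite -(perm_big _ pp) big_cat /= mulrDl.
have nz z : z \in s -> z - x != 0.
  by move=> zs; rewrite subr_eq0; apply: contraNneq xs => <-.
congr (_ + _).
  rewrite /split_term /cleared_left /=; case: ifP => _; first by rewrite mul0r.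
  rewrite big_cons.
  have -> : \prod_(y <- p.2) - ((1 - x * y) * (1 - q * (x * y))) =
      \prod_(y <- p.2) cross_factor q x y * \prod_(y <- p.2) (y - x).
    rewrite -big_split /= big_seq [RHS]big_seq; apply: eq_bigr => y yp.
    have yx : y - x != 0 by apply: nz; rewrite -(perm_mem pp) mem_cat yp orbT.
    rewrite /cross_factor -[x - y]opprB invrN.
    transitivity (- (1 - x * y) * (1 - q * (x * y)) * ((y - x)^-1 * (y - x)));
      [by rewrite mulVf // mulr1; ring | by ring].
  by ring.
rewrite /split_term /cleared_right /=; case: ifP => _; first by rewrite mul0r.
have -> : \prod_(z <- p.1) \prod_(y <- x :: p.2) cross_factor q z y =
    \prod_(z <- p.1) cross_factor q z x * \prod_(z <- p.1) \prod_(y <- p.2) cross_factor q z y.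
  by under eq_bigr => z _ do rewrite big_cons; rewrite big_split.
have -> : \prod_(z <- p.1) ((1 - z * x) * (1 - q * (z * x))) =
    \prod_(z <- p.1) cross_factor q z x * \prod_(z <- p.1) (z - x).
  rewrite -big_split /= big_seq [RHS]big_seq; apply: eq_bigr => z zp.
  have zx : z - x != 0 by apply: nz; rewrite -(perm_mem pp) mem_cat zp.
  by rewrite /cross_factor mulrAC mulfVK.
rewrite big_cons [\prod_(y <- p.2) (_ * _)]big_split /=.
move: (\prod_(i <- p.2) (1 - q * (x * i))) (\prod_(i <- p.2) (i - x)) => P Q.
by ring.
Qed.

Lemma cleared_sum_perm (F : fieldType) (q b t x : F) (s s' : seq F) :
  perm_eq s s' -> cleared_sum q b t x s = cleared_sum q b t x s'.
Proof.
apply: (big_splits_perm (f := fun A B => cleared_left q b t x A B + cleared_right q b t x A B)).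
move=> A A' B B' pA pB; rewrite /cleared_left /cleared_right (perm_size pA).
have pxA : perm_eq (x :: A) (x :: A') by rewrite perm_cons.
rewrite (Znum_perm _ _ _ pxA) (Znum_perm _ _ _ pA) (pair_prod_perm _ pB) !(perm_big _ pB) /=.
have -> : \prod_(z <- A) \prod_(y <- B) cross_factor q z y =
   \prod_(z <- A') \prod_(y <- B') cross_factor q z y.
  by rewrite (perm_big _ pA); apply: eq_bigr => z _; exact: perm_big.
by rewrite !(perm_big _ pA).
Qed.

Lemma cleared_sum_mem (F : fieldType) (q b t x : F) (s : seq F) :
  uniq s -> x \in s -> cleared_sum q b t x s = 0.
Proof.
move=> us xs; have ps := perm_to_rem xs.
have := us; rewrite (perm_uniq ps) /= => /andP[xs' _].
rewrite (cleared_sum_perm _ _ _ _ ps) /cleared_sum.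
rewrite (big_splits_cons x _ (fun A B => cleared_left q b t x A B + cleared_right q b t x A B)).
move: (rem x s) xs' => {ps us xs}s xs.
rewrite big_seq big1 // => p /perm_splits pp.
(* With the head and its copy in [s] on the same side, the clearing product keeps a factor
   [x - x]. *)
have -> : cleared_left q b t x (x :: p.1) p.2 = 0.
  by rewrite /cleared_left [\prod_(z <- x :: p.1) (_ - _)]big_cons subrr !(mul0r, mulr0) if_same.
have -> : cleared_right q b t x p.1 (x :: p.2) = 0.
  rewrite /cleared_right [\prod_(y <- x :: p.2) (_ * _)]big_cons subrr.
  by rewrite !(mul0r, mulr0) if_same.
(* What remains is the head inside with its copy outside, and the reverse. The two terms are
   opposite: the sign comes from [x - y] against [y - x] in the denominators that were cleared. *)
rewrite add0r addr0 /cleared_left /cleared_right /=.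
case: ifP => _; first by rewrite addr0.
have nz z : z \in s -> z - x != 0.
  by move=> zs; rewrite subr_eq0; apply: contraNneq xs => <-.
have -> : \prod_(z <- p.1) \prod_(y <- x :: p.2) cross_factor q z y =
    \prod_(z <- p.1) cross_factor q z x * \prod_(z <- p.1) \prod_(y <- p.2) cross_factor q z y.
  by under eq_bigr => z _ do rewrite big_cons; rewrite big_split.
rewrite !big_cons.
have -> : \prod_(z <- p.1) ((1 - z * x) * (1 - q * (z * x))) =
    \prod_(z <- p.1) cross_factor q z x * \prod_(z <- p.1) (z - x).
  rewrite -big_split /= big_seq [RHS]big_seq; apply: eq_bigr => z zp.
  have zx : z - x != 0 by apply: nz; rewrite -(perm_mem pp) mem_cat zp.
  by rewrite /cross_factor mulrAC mulfVK.
have -> : \prod_(y <- p.2) - ((1 - x * y) * (1 - q * (x * y))) =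
    \prod_(y <- p.2) cross_factor q x y * \prod_(y <- p.2) (y - x).
  rewrite -big_split /= big_seq [RHS]big_seq; apply: eq_bigr => y yp.
  have yx : y - x != 0 by apply: nz; rewrite -(perm_mem pp) mem_cat yp orbT.
  rewrite /cross_factor -[x - y]opprB invrN.
  transitivity (- (1 - x * y) * (1 - q * (x * y)) * ((y - x)^-1 * (y - x)));
    [by rewrite mulVf // mulr1; ring | by ring].
rewrite [\prod_(y <- p.2) ((y - x) * _)]big_split /=.
move: (\prod_(i <- p.2) (1 - q * (x * i))) (\prod_(i <- p.2) (i - x)) => P Q.
by ring.
Qed.

(** With the head in the subset the degrees are 2 per letter of [B], 1 per letter of [A], and
    [2 + size A] from [Znum]; with the head outside they are 2 from [kcoef] and 2 per letter of
    either side. *)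
Lemma poly_fun_cleared_sum (F : fieldType) (q b t : F) (s : seq F) :
  poly_fun (2 + (size s).*2) (fun x => cleared_sum q b t x s).
Proof.
rewrite /cleared_sum.
(* The bound holds only for members of [splits s], whereas [poly_fun_sum] asks for it at every
   index; hence the induction on the list. *)
have sz : forall p, p \in splits s -> (size p.1 + size p.2 = size s)%N.
  by move=> p /perm_splits /perm_size; rewrite size_cat.
elim: (splits s) sz => [|p r IH] sz.
  apply: (@eq_poly_fun _ _ (fun=> 0)); first by move=> x; rewrite big_nil.
  exact: poly_funW (poly_funC 0).
apply: (@eq_poly_fun _ _ (fun x => (cleared_left q b t x p.1 p.2 + cleared_right q b t x p.1 p.2) +
  \sum_(p <- r) (cleared_left q b t x p.1 p.2 + cleared_right q b t x p.1 p.2))).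
  by move=> x; rewrite big_cons.
apply: poly_funD; last by apply: IH => p' pr; apply: sz; rewrite inE pr orbT.
have szp := sz p (mem_head p r).
apply: poly_funD; rewrite /cleared_left /cleared_right; case: (odd _);
  try exact: poly_funW (poly_funC 0); apply: poly_funZ.
  apply: (@poly_funW _ (size p.2 * 2 + size p.1 * 1 + (2 + size p.1))).
    rewrite -szp; move: (size p.1) (size p.2) => m n; lia.
  apply: poly_funM; last exact: poly_fun_Znum.
  apply: poly_funM; apply: poly_fun_prod => y.
    apply: (@eq_poly_fun _ _ (fun x => (- 1 + y * x) * (1 + - (q * y) * x))).
      by move=> x; ring.
    exact: poly_funM (poly_fun_affine _ _) (poly_fun_affine _ _).
  by apply: eq_poly_fun (poly_fun_affine y (- 1)) => x; ring.
apply: (@poly_funW _ (2 + size p.1 * 2 + size p.2 * 2)).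
  rewrite -szp; move: (size p.1) (size p.2) => m n; lia.
apply: poly_funM; first apply: poly_funM; first exact: poly_fun_kcoef.
  apply: poly_fun_prod => z.
  apply: (@eq_poly_fun _ _ (fun x => (1 + - z * x) * (1 + - (q * z) * x))).
    by move=> x; ring.
  exact: poly_funM (poly_fun_affine _ _) (poly_fun_affine _ _).
apply: poly_fun_prod => y.
apply: (@eq_poly_fun _ _ (fun x => (y + - 1 * x) * (1 + - (q * y) * x))).
  by move=> x; ring.
exact: poly_funM (poly_fun_affine _ _) (poly_fun_affine _ _).
Qed.

Lemma poly_fun_eq (F : fieldType) (n : nat) (g h : F -> F) (rs : seq F) :
  poly_fun n g -> poly_fun n h -> uniq rs -> (n < size rs)%N ->
  (forall x, x \in rs -> g x = h x) -> g =1 h.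
Proof.
move=> [p sp gp] [r sr hr] urs nrs ghrs x.
rewrite gp hr; congr (_.[x]); apply/eqP; rewrite -subr_eq0; apply/eqP.
apply: (@roots_geq_poly_eq0 _ _ rs) => //.
  by apply/allP => y yrs; rewrite /root hornerD hornerN -gp -hr ghrs ?subrr.
apply: leq_trans nrs; rewrite (leq_trans (size_polyD _ _)) // size_polyN geq_max.
by rewrite sp.
Qed.

Lemma perm_front2 (T : eqType) (x y : T) (s : seq T) :
  x \in s -> y \in s -> x != y -> exists s', perm_eq s (x :: y :: s').
Proof.
move=> xs ys xy; have ps := perm_to_rem xs.
have yr : y \in rem x s by move: ys; rewrite (perm_mem ps) inE eq_sym (negPf xy).
exists (rem y (rem x s)); apply: perm_trans ps _.
by rewrite perm_cons perm_to_rem.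
Qed.

(* Zero, the fixed points and the 2-cycles of [x -> 1 / x] are where both sides
   reduce to smaller alphabets. *)
Definition reducible (F : fieldType) (s : seq F) : Prop :=
  [\/ 0 \in s, exists2 x, x \in s & dcoef x = 0 |
      exists x y, [/\ x \in s, y \in s, x != y & x * y = 1]].

(** Serves twice: for an alphabet that is reducible itself, and at the interpolation nodes outside
    [s], where adjoining the node makes the alphabet reducible. *)
Lemma Znum_reducible (F : fieldType) (q b t : F) (s : seq F) :
  uniq s -> reducible s ->
  (forall s', (size s' < size s)%N -> uniq s' -> Znum q b t s' = split_sum q b t s') ->
  Znum q b t s = split_sum q b t s.
Proof.
move=> us [s0|[x xs d0]|[x [y [xs ys xy xy1]]]] IH.
- have ps := perm_to_rem s0.
  by rewrite (Znum_perm _ _ _ ps) (split_sum_perm _ _ _ ps) Znum0 split_sum0.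
- have ps := perm_to_rem xs.
  have := us; rewrite (perm_uniq ps) /= => /andP[xs' us'].
  rewrite (Znum_perm _ _ _ ps) (split_sum_perm _ _ _ ps) Znum_dcoef0 //.
  by rewrite split_sum_dcoef0 // IH // (perm_size ps) /=.
have [s' ps] := perm_front2 xs ys xy.
have := us; rewrite (perm_uniq ps) /= inE negb_or => /and3P[/andP[_ xs'] ys' us'].
rewrite (Znum_perm _ _ _ ps) (split_sum_perm _ _ _ ps) Znum_inverse_pair //.
by rewrite split_sum_inverse_pair // IH // (perm_size ps) /=.
Qed.

Lemma Znum_split_sum (F : fieldType) (q b t : F) (s : seq F) :
  1 != -1 :> F -> uniq s -> Znum q b t s = split_sum q b t s.
Proof.
move=> char2; have [n] := ubnP (size s).
elim: n s => // n IHn s ssn us.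
have IH s' : (size s' < size s)%N -> uniq s' -> Znum q b t s' = split_sum q b t s'.
  by move=> ss'; apply: IHn; apply: leq_trans ss' _; rewrite -ltnS.
case: s us IH {ssn} => [|x s] us IH.
  by rewrite /split_sum big_seq1 /split_term /Znum /= !big_nil !mulr1.
have /andP[xs us'] : (x \notin s) && uniq s := us.
case: (boolP (x * \prod_(y <- s) y == 0)) => [|nz0].
  rewrite mulf_eq0 prodf_seq_eq0 => /orP[/eqP x0|/hasP[y ys /= /eqP y0]];
  by apply: Znum_reducible => //; constructor 1; rewrite inE -?x0 ?eqxx // -y0 ys orbT.
have s0 : 0 \notin s.
  apply: contra nz0 => s0; rewrite mulf_eq0 prodf_seq_eq0; apply/orP; right.
  by apply/hasP; exists 0 => /=.
case: (boolP (has (fun y => dcoef y == 0) s)) => [/hasP[y ys /eqP d0]|nd].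
  by apply: Znum_reducible => //; constructor 2; exists y; rewrite // inE ys orbT.
case: (boolP (has (fun y => has (fun z => (y != z) && (y * z == 1)) s) s)) => [|np].
  move=> /hasP[y ys /hasP[z zs /andP[yz /eqP yz1]]].
  apply: Znum_reducible => //; constructor 3; exists y, z.
  by rewrite !inE ys zs !orbT.
(* The case [y = z] is included: there [y * y = 1] would mean [dcoef y = 0]. *)
have inv_notin y z : y \in s -> z \in s -> y * z != 1.
  move=> ys zs; case: (eqVneq y z) => [<-|yz].
    move/hasPn/(_ _ ys): nd; apply: contra => /eqP e.
    by rewrite /dcoef expr2 e subrr.
  by move/hasPn/(_ _ ys)/hasPn/(_ _ zs): np; rewrite yz.
have dP y : y \in s -> y != 1 /\ y != -1.
  move=> ys; move/hasPn/(_ _ ys): nd; rewrite /dcoef => nd.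
  by split; apply: contra nd => /eqP ->; rewrite ?sqrrN expr1n subrr.
have y_neq0 y : y \in s -> y != 0.
  by move=> ys; apply: contraNneq s0 => <-.
(* These are [3 + 2 * size s] points, one more than the degree bound; [1 != -1] and the
   irreducibility of [s] make them distinct. *)
pose nodes := [:: 0, 1, -1 & [seq y^-1 | y <- s]] ++ s.
have notin_s z : z \in [:: 0, 1, -1 & [seq y^-1 | y <- s]] -> z \notin s.
  rewrite !inE => /or4P[/eqP->|/eqP->|/eqP->|/mapP[y ys ->]] //.
  - by apply/negP => /dP[]; rewrite eqxx.
  - by apply/negP => /dP[]; rewrite eqxx.
  apply/negP => ys'; have := inv_notin _ _ ys ys'.
  by rewrite mulfV ?eqxx ?y_neq0.
have u_nodes : uniq nodes.
  rewrite cat_uniq us' andbT; apply/andP; split; last first.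
    by apply/hasPn => z zs; apply: contraL zs; exact: notin_s.
  rewrite /= !inE !negb_or; do ?(apply/andP; split) => //.
  - by rewrite eq_sym oner_neq0.
  - by rewrite eq_sym oppr_eq0 oner_neq0.
  - by apply/negP => /mapP[y ys /eqP]; rewrite eq_sym invr_eq0 (negPf (y_neq0 _ ys)).
  - apply/negP => /mapP[y ys /(congr1 (@GRing.inv F))].
    by rewrite invr1 invrK => e; have [] := dP _ ys; rewrite -e eqxx.
  - apply/negP => /mapP[y ys /(congr1 (@GRing.inv F))].
    by rewrite invrN invr1 invrK => e; have [] := dP _ ys; rewrite -e eqxx.
  - by rewrite map_inj_uniq //; exact: invr_inj.
have agree : (fun z => Znum q b t (z :: s) * \prod_(y <- s) (y - z)) =1
    (fun z => cleared_sum q b t z s).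
  apply: (@poly_fun_eq _ (2 + (size s).*2) _ _ nodes) => //.
  - rewrite -addnn addnA; apply: poly_funM; first exact: poly_fun_Znum.
    rewrite -[X in poly_fun X]muln1; apply: poly_fun_prod => y.
    by apply: eq_poly_fun (poly_fun_affine y (- 1)) => z; ring.
  - exact: poly_fun_cleared_sum.
  - by rewrite size_cat /= size_map; lia.
  move=> z; rewrite mem_cat => /orP[zn|zs]; last first.
    rewrite cleared_sum_mem // (perm_big _ (perm_to_rem zs)) big_cons subrr /=.
    by rewrite mul0r mulr0.
  rewrite -cleared_sumE ?notin_s //; congr (_ * _).
  apply: Znum_reducible => //=; first by rewrite notin_s.
  move: (zn); rewrite !inE => /or4P[/eqP->|/eqP->|/eqP->|/mapP[y ys ez]].
  - by constructor 1; rewrite mem_head.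
  - by constructor 2; exists 1; rewrite ?mem_head // /dcoef expr1n subrr.
  - by constructor 2; exists (-1); rewrite ?mem_head // /dcoef sqrrN expr1n subrr.
  constructor 3; exists z, y; rewrite !inE eqxx ys orbT; split => //.
    by apply: contraNneq (notin_s _ zn) => ->.
  by rewrite ez mulVf ?y_neq0.
have nz : \prod_(y <- s) (y - x) != 0.
  rewrite prodf_seq_neq0; apply/allP => y ys /=.
  by rewrite subr_eq0; apply: contraNneq xs => <-.
by apply: (mulIf nz); rewrite agree cleared_sumE.
Qed.

(** * From edge configurations to row recursion *)

Definition set_edge (E : eqType) (A : E -> bool) (e : E) (u : bool) : E -> bool :=
  fun e' => if e' == e then u else A e'.

(** Sums over states one edge at a time, [A] holding the states already fixed. The order of the
    edges can then be chosen to follow the recursion of [lattice_sum]. *)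
Fixpoint edge_sum (R : comNzRingType) (E : eqType) (es : seq E)
    (f : (E -> bool) -> R) (A : E -> bool) : R :=
  if es is e :: es' then \sum_(u : bool) edge_sum es' f (set_edge A e u) else f A.

Lemma edge_sum_cons (R : comNzRingType) (E : eqType) (e : E) (es : seq E)
    (f : (E -> bool) -> R) (A : E -> bool) :
  edge_sum (e :: es) f A = \sum_(u : bool) edge_sum es f (set_edge A e u).
Proof. by []. Qed.

Lemma eq_edge_sum (R : comNzRingType) (E : eqType) (es : seq E)
    (f g : (E -> bool) -> R) (A : E -> bool) :
  (forall B, (forall e, e \notin es -> B e = A e) -> f B = g B) ->
  edge_sum es f A = edge_sum es g A.
Proof.
elim: es A => [|e es IH] A fg /=; first exact: fg.
apply: eq_bigr => u _; apply: IH => B BA; apply: fg => e'.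
rewrite inE negb_or => /andP[e'e e'es].
by rewrite BA // /set_edge (negPf e'e).
Qed.

Lemma edge_sumZ (R : comNzRingType) (E : eqType) (es : seq E) (c : R)
    (f : (E -> bool) -> R) (A : E -> bool) :
  edge_sum es (fun B => c * f B) A = c * edge_sum es f A.
Proof.
elim: es A => [|e es IH] A //=.
by rewrite mulr_sumr; apply: eq_bigr => u _; rewrite IH.
Qed.

Lemma edge_sum_pull (R : comNzRingType) (E : eqType) (es : seq E)
    (g f : (E -> bool) -> R) (A : E -> bool) :
  (forall B, (forall e, e \notin es -> B e = A e) -> g B = g A) ->
  edge_sum es (fun B => g B * f B) A = g A * edge_sum es f A.
Proof.
by move=> gA; rewrite -edge_sumZ; apply: eq_edge_sum => B BA; rewrite gA.
Qed.

Lemma edge_sum_cat (R : comNzRingType) (E : eqType) (es es' : seq E)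
    (f : (E -> bool) -> R) (A : E -> bool) :
  edge_sum (es ++ es') f A = edge_sum es (edge_sum es' f) A.
Proof. by elim: es A => [|e es IH] A //=; apply: eq_bigr => u _. Qed.

Lemma edge_sum_map (R : comNzRingType) (E E' : eqType) (h : E -> E') (es : seq E)
    (f : (E -> bool) -> R) (A : E' -> bool) :
  injective h ->
  edge_sum (map h es) (fun B => f (B \o h)) A = edge_sum es f (A \o h).
Proof.
move=> inj_h; elim: es A => [|e es IH] A //=.
apply: eq_bigr => u _; rewrite IH; congr edge_sum.
by apply/funext => e'; rewrite /set_edge /= inj_eq.
Qed.

Lemma edge_sum_perm (R : comNzRingType) (E : eqType) (es es' : seq E)
    (f : (E -> bool) -> R) (A : E -> bool) :
  uniq es -> perm_eq es es' -> edge_sum es f A = edge_sum es' f A.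
Proof.
have move_front e s1 s2 B : e \notin s1 ->
    edge_sum (s1 ++ e :: s2) f B = edge_sum (e :: s1 ++ s2) f B.
  elim: s1 B => [|e1 s1 IH] B //=; rewrite inE negb_or => /andP[ee1 es1].
  under eq_bigr => u _ do rewrite IH //=.
  rewrite exchange_big; apply: eq_bigr => u _; apply: eq_bigr => u' _.
  congr edge_sum; apply/funext => e'; rewrite /set_edge.
  by case: (eqVneq e' e) => // ->; rewrite (negPf ee1).
elim: es es' A => [|e es IH] es' A; first by rewrite perm_sym => _ /perm_nilP ->.
move=> ues pp; have ees' : e \in es' by rewrite -(perm_mem pp) mem_head.
have := ues; rewrite (perm_uniq pp) => ues'.
case/splitPr: ees' pp ues' => s1 s2 pp ues'.
rewrite move_front; last first.
  by move: ues'; rewrite cat_uniq /= negb_or => /and3P[_ /andP[]].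
rewrite /=; apply: eq_bigr => u _; apply: IH; first by case/andP: ues.
by rewrite -(perm_cons e) (perm_trans pp) // -[e :: s2]cat1s perm_catCA.
Qed.

Lemma sum_ffun_edge_sum (R : comNzRingType) (T : finType) (P : pred T)
    (f : (T -> bool) -> R) :
  \sum_(v : {ffun T -> bool} | [forall e, v e ==> P e]) f v =
  edge_sum (enum P) f (fun=> false).
Proof.
(* The default [A] outside [es] must be arbitrary, because each edge peeled off the list is written
   into it. *)
suff H (es : seq T) A : uniq es ->
    \sum_(v : {ffun T -> bool} | [forall e, v e ==> (e \in es)])
      f (fun e => if e \in es then v e else A e) = edge_sum es f A.
  rewrite -H ?enum_uniq //; apply: eq_big => [v|v /forallP vP].
    by apply: eq_forallb => e; rewrite mem_enum.
  congr f; apply/funext => e; rewrite mem_enum; case: ifP => // Pe.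
  by have := vP e; rewrite -[P e]/(e \in P) Pe implybF => /negbTE.
elim: es A => [|e es IH] A /=.
  move=> _; rewrite (big_pred1 [ffun=> false]) // => v; apply/forallP/eqP.
    by move=> vF; apply/ffunP => e; rewrite ffunE; have := vF e; rewrite implybF => /negbTE.
  by move=> -> e; rewrite ffunE.
case/andP=> ees ues; rewrite (partition_big (fun v : {ffun T -> bool} => v e) xpredT) //=.
apply: eq_bigr => u _.
(* Functions with value [u] at [e] are matched with those that are false at [e], as the support
   condition for [es] requires. *)
pose upd u (v : {ffun T -> bool}) := [ffun e' => if e' == e then u else v e'].
rewrite (reindex_onto (upd u) (upd false)) /=; last first.
  move=> v /andP[_ /eqP veu]; apply/ffunP => e'; rewrite !ffunE.
  by case: eqP => // ->.
rewrite -IH //; apply: eq_big => [v|v].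
  apply/idP/idP.
    move=> /andP[/andP[/forallP vP _] /eqP ve]; apply/forallP => e'.
    have := vP e'; rewrite ffunE inE; case: (eqVneq e' e) => //= ->.
    by rewrite -ve !ffunE eqxx.
  move=> /forallP vP; rewrite !ffunE !eqxx andbT; apply/andP; split.
    apply/forallP => e'; rewrite ffunE inE; case: (eqVneq e' e) => //= _.
      by rewrite implybT.
  apply/eqP/ffunP => e'; rewrite !ffunE; case: (eqVneq e' e) => // ->.
  by have := vP e; rewrite (negPf ees) implybF => /negbTE.
move=> _; congr f; apply/funext => e'; rewrite ffunE inE /set_edge.
by case: (eqVneq e' e) => //= ->; rewrite (negPf ees).
Qed.

(* [vedge i k] is the segment of vertical line [i] below row [k], and
   [hedge j k] the segment of row [j] to the left of vertical line [k]. *)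
Definition edge : eqType := (bool * (nat * nat))%type.
Definition vedge (i k : nat) : edge := (true, (i, k)).
Definition hedge (j k : nat) : edge := (false, (j, k)).

Lemma edge_eqE (o o' : bool) (j j' k k' : nat) :
  ((o, (j, k)) == (o', (j', k')) :> edge) = [&& o == o', j == j' & k == k'].
Proof. by []. Qed.

(** A row segment is summed over only if [d > 0] lines remain to its right; otherwise it is the
    exit, whose state is fixed. *)
Definition inner_edge (d : nat) (e : edge) : seq edge :=
  if d is 0 then [::] else [:: e].

(** The edges leaving the crossings of row [n] with lines [i], ..., [i + d - 1], in the order in
    which [row_sum] sums over them: top, then right. *)
Fixpoint row_edges (n i d : nat) : seq edge :=
  if d is d'.+1 then
    vedge i n.+1 :: inner_edge d' (hedge n i.+1) ++ row_edges n i.+1 d'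
  else [::].

Fixpoint lattice_edges (n d : nat) : seq edge :=
  if d is d'.+1 then
    inner_edge d' (hedge n n.+1) ++ row_edges n n.+1 d' ++ lattice_edges n.+1 d'
  else [::].

Lemma row_edgesS (n i d : nat) :
  row_edges n i d.+1 = vedge i n.+1 :: inner_edge d (hedge n i.+1) ++ row_edges n i.+1 d.
Proof. by []. Qed.

Lemma lattice_edgesS (n d : nat) :
  lattice_edges n d.+1 =
  inner_edge d (hedge n n.+1) ++ row_edges n n.+1 d ++ lattice_edges n.+1 d.
Proof. by []. Qed.

Lemma mem_inner_edge (d : nat) (e e' : edge) :
  (e \in inner_edge d e') = (0 < d)%N && (e == e').
Proof. by case: d => [|d]; rewrite ?in_nil ?inE. Qed.

Lemma mem_row_edges (n i d : nat) (o : bool) (j k : nat) :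
  (((o, (j, k)) : edge) \in row_edges n i d) =
  if o then (k == n.+1) && (i <= j < i + d)%N else (j == n) && (i < k < i + d)%N.
Proof.
elim: d i => [|d IH] i; first by case: o; rewrite in_nil; lia.
rewrite row_edgesS in_cons mem_cat IH mem_inner_edge !edge_eqE.
by case: o {IH}; lia.
Qed.

Lemma mem_lattice_edges (n d : nat) (o : bool) (j k : nat) :
  (((o, (j, k)) : edge) \in lattice_edges n d) =
  if o then (n < k <= j)%N && (j < n + d)%N else (n <= j < k)%N && (k < n + d)%N.
Proof.
elim: d n => [|d IH] n; first by case: o; rewrite in_nil; lia.
rewrite lattice_edgesS !mem_cat IH mem_row_edges mem_inner_edge !edge_eqE.
by case: o {IH}; lia.
Qed.

Lemma uniq_inner_edge (d : nat) (e : edge) : uniq (inner_edge d e).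
Proof. by case: d. Qed.

Lemma uniq_row_edges (n i d : nat) : uniq (row_edges n i d).
Proof.
elim: d i => [|d IH] i //.
rewrite row_edgesS cons_uniq cat_uniq uniq_inner_edge IH andbT.
rewrite mem_cat mem_inner_edge mem_row_edges edge_eqE; apply/andP; split; first lia.
by apply/hasPn => -[o [j k]]; rewrite mem_row_edges mem_inner_edge edge_eqE; case: o; lia.
Qed.

Lemma uniq_lattice_edges (n d : nat) : uniq (lattice_edges n d).
Proof.
elim: d n => [|d IH] n //.
rewrite lattice_edgesS !cat_uniq uniq_inner_edge uniq_row_edges IH /= andbT.
apply/andP; split; apply/hasPn => -[o [j k]];
  by rewrite ?mem_cat mem_lattice_edges ?mem_row_edges ?mem_inner_edge ?edge_eqE; case: o; lia.
Qed.

Fixpoint row_weight (R : comNzRingType) (q : R) (X : nat -> R) (n i d : nat)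
    (A : edge -> bool) : R :=
  if d is d'.+1 then
    bulk_num q (X n * X i)
      (A (vedge i n)) (A (hedge n i)) (A (vedge i n.+1)) (A (hedge n i.+1)) *
    row_weight q X n i.+1 d' A
  else 1.

Fixpoint lattice_weight (R : comNzRingType) (q b t : R) (X : nat -> R) (n d : nat)
    (A : edge -> bool) : R :=
  if d is d'.+1 then
    boundary_num b t (X n) (A (vedge n n)) (A (hedge n n.+1)) *
    (row_weight q X n n.+1 d' A * lattice_weight q b t X n.+1 d' A)
  else 1.

Lemma set_edge_eq (E : eqType) (A : E -> bool) (e : E) (u : bool) : set_edge A e u e = u.
Proof. by rewrite /set_edge eqxx. Qed.

Lemma set_edge_neq (E : eqType) (A : E -> bool) (e e' : E) (u : bool) :
  e' != e -> set_edge A e u e' = A e'.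
Proof. by rewrite /set_edge => /negbTE ->. Qed.

(** Invariant along row [n]: the lines from [n.+1] up to but excluding [i] are already crossed, and
    their top states, stored in [A], form the prefix passed to [f]. The edges [hedge j m] are the
    exits. *)
Lemma edge_sum_row (R : comNzRingType) (q b t : R) (X : nat -> R) (m n i d : nat)
    (f : seq bool -> R) (A : edge -> bool) :
  (i + d = m)%N -> (n < i)%N ->
  (forall B, (forall j, B (hedge j m) = false) ->
    edge_sum (lattice_edges n.+1 (m - n.+1)) (lattice_weight q b t X n.+1 (m - n.+1)) B =
    f [seq B (vedge i' n.+1) | i' <- iota n.+1 (m - n.+1)]) ->
  (forall j, A (hedge j m) = false) ->
  edge_sum (row_edges n i d ++ lattice_edges n.+1 (m - n.+1))
    (fun B => row_weight q X n i d B * lattice_weight q b t X n.+1 (m - n.+1) B) A =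
  row_sum q (X n) [seq X i' | i' <- iota i d] (A (hedge n i))
    [seq A (vedge i' n) | i' <- iota i d]
    (fun ts => f ([seq A (vedge i' n.+1) | i' <- iota n.+1 (i - n.+1)] ++ ts)).
Proof.
move=> + + fP; elim: d i A => [|d IH] i A.
  rewrite addn0 => -> nm Am /=; rewrite Am cats0 -fP //.
  by apply: eq_edge_sum => B _; rewrite mul1r.
move=> idm ni Am; rewrite row_edgesS cat_cons.
have idm' : (i.+1 + d = m)%N by lia.
have ni' : (n < i.+1)%N by lia.
pose g (A : edge -> bool) := bulk_num q (X n * X i)
  (A (vedge i n)) (A (hedge n i)) (A (vedge i n.+1)) (A (hedge n i.+1)).
have gP B C : (forall e, e \notin row_edges n i.+1 d ++ lattice_edges n.+1 (m - n.+1) ->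
    C e = B e) -> g C = g B.
  move=> CB; rewrite /g !CB // /vedge /hedge mem_cat mem_row_edges mem_lattice_edges; lia.
have prefix B u : [seq set_edge B (vedge i n.+1) u (vedge i' n.+1) | i' <- iota n.+1 (i.+1 - n.+1)] =
    [seq B (vedge i' n.+1) | i' <- iota n.+1 (i - n.+1)] ++ [:: u].
  have -> : (i.+1 - n.+1 = (i - n.+1) + 1)%N by lia.
  rewrite iotaD map_cat; congr (_ ++ _).
    apply/eq_in_map => j; rewrite mem_iota => jP; apply: set_edge_neq.
    by rewrite /vedge edge_eqE; lia.
  rewrite /=; have -> : (n.+1 + (i - n.+1) = i)%N by lia.
  by rewrite set_edge_eq.
have pull B : edge_sum (row_edges n i.+1 d ++ lattice_edges n.+1 (m - n.+1))
    (fun B => row_weight q X n i d.+1 B * lattice_weight q b t X n.+1 (m - n.+1) B) B =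
  g B * edge_sum (row_edges n i.+1 d ++ lattice_edges n.+1 (m - n.+1))
    (fun B => row_weight q X n i.+1 d B * lattice_weight q b t X n.+1 (m - n.+1) B) B.
  rewrite -edge_sum_pull; last exact: gP.
  by apply: eq_edge_sum => C _; rewrite /= mulrA.
rewrite [RHS]/= -(pair_bigA _ (fun t0 r => bulk_num q (X n * X i) (A (vedge i n))
  (A (hedge n i)) t0 r * row_sum q (X n) [seq X i' | i' <- iota i.+1 d] r
    [seq A (vedge i' n) | i' <- iota i.+1 d]
    (fun ts => f ([seq A (vedge i' n.+1) | i' <- iota n.+1 (i - n.+1)] ++ t0 :: ts)))).
rewrite edge_sum_cons; apply: eq_bigr => u _; rewrite [RHS]/=; set A1 := set_edge A _ u.
(* On the last line the right segment is the exit [hedge n m] and is not summed; accordingly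
   [row_sum] gives 0 to the outgoing state 1. *)
case: d => [|d] in idm idm' IH gP pull *.
  have A1m j : A1 (hedge j m) = false.
    by rewrite /A1 set_edge_neq ?Am // /vedge /hedge edge_eqE.
  rewrite [inner_edge _ _]/= cat0s pull (IH _ _ idm' ni' A1m).
  have im : i.+1 = m by lia.
  rewrite big_bool /= (prefix A u) im A1m mulr0 add0r -catA /g im A1m /A1 set_edge_eq.
  by rewrite !set_edge_neq // /vedge /hedge edge_eqE; lia.
rewrite [inner_edge _ _]/= cat1s cat_cons.
rewrite edge_sum_cons; apply: eq_bigr => r _; rewrite pull.
have A2m j : set_edge A1 (hedge n i.+1) r (hedge j m) = false.
  by rewrite /A1 !set_edge_neq ?Am // /vedge /hedge edge_eqE; lia.
rewrite (IH _ _ idm' ni' A2m).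
rewrite set_edge_eq; congr (_ * _).
  rewrite /g set_edge_eq; congr bulk_num; rewrite set_edge_neq // /A1 ?set_edge_eq //;
    by rewrite ?set_edge_neq // /vedge /hedge edge_eqE; lia.
have -> : [seq set_edge A1 (hedge n i.+1) r (vedge i' n) | i' <- iota i.+1 d.+1] =
    [seq A (vedge i' n) | i' <- iota i.+1 d.+1].
  by apply: eq_map => j; rewrite /A1 !set_edge_neq // /vedge /hedge edge_eqE; lia.
apply: eq_row_sum => ts; rewrite -[u :: ts]cat1s catA -prefix; congr (f (_ ++ _)).
Qed.

Lemma edge_sum_lattice (R : comNzRingType) (q b t : R) (X : nat -> R) (m n d : nat)
    (A : edge -> bool) :
  (n + d = m)%N -> (forall j, A (hedge j m) = false) ->
  edge_sum (lattice_edges n d) (lattice_weight q b t X n d) A =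
  lattice_sum q b t [seq X i | i <- iota n d] [seq A (vedge i n) | i <- iota n d].
Proof.
elim: d n A => [|d IH] n A // ndm Am.
have dE : d = (m - n.+1)%N by lia.
pose g (A : edge -> bool) := boundary_num b t (X n) (A (vedge n n)) (A (hedge n n.+1)).
have gP B C : (forall e, e \notin row_edges n n.+1 d ++ lattice_edges n.+1 d ->
    C e = B e) -> g C = g B.
  move=> CB; rewrite /g !CB // /vedge /hedge mem_cat mem_row_edges mem_lattice_edges; lia.
have step B : (forall j, B (hedge j m) = false) ->
    edge_sum (row_edges n n.+1 d ++ lattice_edges n.+1 d)
      (lattice_weight q b t X n d.+1) B =
    g B * row_sum q (X n) [seq X i | i <- iota n.+1 d] (B (hedge n n.+1))
      [seq B (vedge i n) | i <- iota n.+1 d] (lattice_sum q b t [seq X i | i <- iota n.+1 d]).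
  move=> Bm; rewrite (edge_sum_pull (g := g)); last exact: gP.
  have ndm' : (n.+1 + d = m)%N by lia.
  have fP C : (forall j, C (hedge j m) = false) ->
      edge_sum (lattice_edges n.+1 (m - n.+1)) (lattice_weight q b t X n.+1 (m - n.+1)) C =
      lattice_sum q b t [seq X i | i <- iota n.+1 d]
        [seq C (vedge i n.+1) | i <- iota n.+1 (m - n.+1)].
    by move=> Cm; rewrite -dE IH.
  congr (_ * _); have := edge_sum_row ndm' (ltnSn n) fP Bm; rewrite -dE => ->.
  by apply: eq_row_sum => ts; rewrite subnn.
rewrite lattice_edgesS [RHS]/=.
case: d => [|d] in ndm IH dE gP step *.
  have nm : n.+1 = m by lia.
  rewrite [inner_edge _ _]/= cat0s step // big_bool /= /g nm !Am /= mulr0 add0r.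
  by [].
rewrite [inner_edge _ _]/= cat1s edge_sum_cons; apply: eq_bigr => w _.
rewrite step; last first.
  by move=> j; rewrite set_edge_neq ?Am // /hedge edge_eqE; lia.
rewrite set_edge_eq; congr (_ * _).
  by rewrite /g set_edge_eq set_edge_neq.
Qed.

Lemma row_weightE (R : comNzRingType) (q : R) (X : nat -> R) (n i d : nat)
    (A : edge -> bool) :
  row_weight q X n i d A =
  \prod_(i <= k < i + d) bulk_num q (X n * X k)
    (A (vedge k n)) (A (hedge n k)) (A (vedge k n.+1)) (A (hedge n k.+1)).
Proof.
elim: d i => [|d IH] i; first by rewrite addn0 big_geq.
by rewrite big_ltn ?addnS ?ltnS ?leq_addr // /= IH addSn.
Qed.

Lemma lattice_weightE (R : comNzRingType) (q b t : R) (X : nat -> R) (n d : nat)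
    (A : edge -> bool) :
  lattice_weight q b t X n d A =
  \prod_(n <= j < n + d) (boundary_num b t (X j) (A (vedge j j)) (A (hedge j j.+1)) *
    \prod_(j.+1 <= k < n + d) bulk_num q (X j * X k)
      (A (vedge k j)) (A (hedge j k)) (A (vedge k j.+1)) (A (hedge j k.+1))).
Proof.
elim: d n => [|d IH] n; first by rewrite addn0 big_geq.
rewrite big_ltn ?addnS ?ltnS ?leq_addr // -addSn /= IH row_weightE addSn.
by rewrite mulrA.
Qed.

Lemma pair_prodE (R : comNzRingType) (q : R) (X : nat -> R) (n d : nat) :
  pair_prod q [seq X i | i <- iota n d] =
  \prod_(n <= j < n + d) \prod_(j.+1 <= k < n + d) (1 - q * (X j * X k)).
Proof.
elim: d n => [|d IH] n; first by rewrite addn0 big_geq.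
rewrite big_ltn ?addnS ?ltnS ?leq_addr // -addSn /= IH; congr (_ * _).
by rewrite big_map /index_iota addnC addnK.
Qed.

Lemma prod_triangle (R : comNzRingType) (m : nat) (G : nat -> nat -> R) :
  \prod_(i < m) \prod_(j < m | (j < i)%N) G j i =
  \prod_(0 <= j < m) \prod_(j.+1 <= i < m) G j i.
Proof.
rewrite (exchange_big_dep xpredT) //= big_mkord; apply: eq_bigr => j _.
by rewrite big_geq_mkord.
Qed.

Definition alphabet (T : Type) (m : nat) (x : 'I_m -> T) : seq T := [seq x i | i <- enum 'I_m].

Lemma nth_alphabet (T : Type) (m : nat) (x : 'I_m -> T) (y : T) (i : 'I_m) :
  nth y (alphabet x) i = x i.
Proof. by rewrite (nth_map i) ?size_enum_ord // nth_ord_enum. Qed.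

Lemma alphabet_iota (T : Type) (m : nat) (x : 'I_m -> T) (y : T) :
  [seq nth y (alphabet x) i | i <- iota 0 m] = alphabet x.
Proof.
by rewrite -[X in iota 0 X](size_enum_ord m) -(size_map x) map_nth_iota0 ?take_size.
Qed.

Lemma pair_prod_alphabet (R : comNzRingType) (q : R) (m : nat) (x : 'I_m -> R) :
  pair_prod q (alphabet x) = \prod_(i < m) \prod_(j < m | (j < i)%N) (1 - q * (x i * x j)).
Proof.
rewrite -(alphabet_iota x 0) pair_prodE add0n -prod_triangle.
apply: eq_bigr => i _; apply: eq_bigr => j _.
by rewrite !nth_alphabet [x i * x j]mulrC.
Qed.

(** The functions [v] and [w] are the restrictions of one edge assignment to vertical and horizontal
    segments, so the double sum is a single [edge_sum]. *)
Lemma sum_states_num (R : comNzRingType) (q b t : R) (m : nat) (x : 'I_m -> R) :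
  \sum_(v : {ffun 'I_m * 'I_m.+1 -> bool} | vertical_state v)
  \sum_(w : {ffun 'I_m * 'I_m.+1 -> bool} | horizontal_state w)
    ((\prod_(i < m) boundary_num b t (x i) (v (i, inord i)) (w (i, inord i.+1))) *
     \prod_(i < m) \prod_(j < m | (j < i)%N)
      bulk_num q (x i * x j)
        (v (i, inord j)) (w (j, inord i)) (v (i, inord j.+1)) (w (j, inord i.+1))) =
  Znum q b t (alphabet x).
Proof.
pose T := ('I_m * 'I_m.+1)%type.
pose X := nth 0 (alphabet x).
pose hv (e : T) : edge := vedge e.1 e.2; pose hh (e : T) : edge := hedge e.1 e.2.
have inj_hv : injective hv by move=> [i k] [j l] [] /val_inj -> /val_inj ->.
have inj_hh : injective hh by move=> [i k] [j l] [] /val_inj -> /val_inj ->.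
pose Pv (e : T) := (0 < e.2 <= e.1)%N; pose Ph (e : T) := (e.1 < e.2 < m)%N.
pose SN (v w : T -> bool) :=
  (\prod_(i < m) boundary_num b t (x i) (v (i, inord i)) (w (i, inord i.+1))) *
     \prod_(i < m) \prod_(j < m | (j < i)%N)
      bulk_num q (x i * x j)
        (v (i, inord j)) (w (j, inord i)) (v (i, inord j.+1)) (w (j, inord i.+1)).
transitivity (edge_sum (enum Pv) (fun v => edge_sum (enum Ph) (SN v) (fun=> false)) (fun=> false)).
  rewrite -sum_ffun_edge_sum; apply: eq_big => [v|v _].
    apply/forallP/forallP => [vP [i k]|vP i]; first by have /forallP := vP i; apply.
    by apply/forallP => k; exact: (vP (i, k)).
  rewrite -(sum_ffun_edge_sum Ph (SN v)); apply: eq_bigl => w.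
  apply/forallP/forallP => [wP [i k]|wP i]; first by have /forallP := wP i; apply.
  by apply/forallP => k; exact: (wP (i, k)).
have SNE (A : edge -> bool) : SN (A \o hv) (A \o hh) = lattice_weight q b t X 0 m A.
  rewrite lattice_weightE add0n big_split /= -prod_triangle big_mkord /SN.
  congr (_ * _); apply: eq_bigr => i _.
    by rewrite /X nth_alphabet /hv /hh /= !inordK // ltnS // ltnW.
  apply: eq_bigr => j ji; rewrite /X !nth_alphabet [x j * x i]mulrC /hv /hh /=.
  by rewrite !inordK // ltnS // ltnW.
transitivity (edge_sum (map hv (enum Pv) ++ map hh (enum Ph))
    (lattice_weight q b t X 0 m) (fun=> false)).
  rewrite edge_sum_cat -(edge_sum_map _ _ (fun=> false) inj_hv).
  apply: eq_edge_sum => B BF.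
  transitivity (edge_sum (enum Ph) (SN (B \o hv)) (B \o hh)).
    congr edge_sum; apply/funext => e; rewrite /= BF //.
    by apply/negP => /mapP[].
  rewrite -(edge_sum_map _ _ _ inj_hh); apply: eq_edge_sum => C CB.
  rewrite -SNE; congr SN; apply/funext => e; rewrite /= CB //.
  by apply/negP => /mapP[].
(* Passes from all vertical edges followed by all horizontal ones to the row-by-row order. *)
rewrite (@edge_sum_perm _ _ _ (lattice_edges 0 m)); first last.
- apply: uniq_perm; last 1 first.
  + move=> [[] [j k]]; rewrite mem_cat mem_lattice_edges add0n.
      have -> : ((true, (j, k)) : edge) \in [seq hh i | i <- enum Ph] = false.
        by apply/negP => /mapP[].
      rewrite orbF; apply/mapP/idP => [[[i l]]|/andP[jk jm]].
        by rewrite mem_enum => ilP [-> ->]; rewrite ltn_ord andbT.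
      have km : (k < m.+1)%N by lia.
      by exists (Ordinal jm, Ordinal km); rewrite ?mem_enum.
    have -> : ((false, (j, k)) : edge) \in [seq hv i | i <- enum Pv] = false.
      by apply/negP => /mapP[].
    apply/mapP/idP => [[[i l]]|/andP[jk km]].
      by rewrite mem_enum => ilP [-> ->].
    have jm : (j < m)%N by lia.
    have km' : (k < m.+1)%N by lia.
    by exists (Ordinal jm, Ordinal km'); rewrite ?mem_enum //; apply/andP.
  + rewrite cat_uniq !map_inj_uniq ?enum_uniq // andbT /=.
    by apply/hasPn => e /mapP[e' _ ->]; apply/negP => /mapP[].
  + exact: uniq_lattice_edges.
- rewrite cat_uniq !map_inj_uniq ?enum_uniq // andbT /=.
  by apply/hasPn => e /mapP[e' _ ->]; apply/negP => /mapP[].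
rewrite (@edge_sum_lattice _ _ _ _ _ m) // alphabet_iota /Znum size_map size_enum_ord.
congr lattice_sum; apply: (@eq_from_nth _ false); first by rewrite size_map size_iota size_nseq.
by move=> i; rewrite size_map size_iota => im; rewrite (nth_map 0%N) ?size_iota // nth_nseq im.
Qed.

(** * The expansion *)

(** The normalisation [g] and the parameters [b], [t] are left free so that the lemma covers both
    [Z] and [ZK]. *)
Lemma Z_Znum (F : fieldType) (q a c b t : F) (m : nat) (x g : 'I_m -> F) :
  (forall i j, i != j -> 1 - q * (x i * x j) != 0) ->
  (forall i s s', boundary_weight a c (x i) s s' = g i * boundary_num b t (x i) s s') ->
  Z q a c x = \prod_(i < m) g i / pair_prod q (alphabet x) * Znum q b t (alphabet x).
Proof.
move=> bulk_def hK; rewrite -sum_states_num mulr_sumr; apply: eq_bigr => v _.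
rewrite mulr_sumr; apply: eq_bigr => w _; rewrite /state_weight pair_prod_alphabet.
under eq_bigr => i _ do rewrite hK.
rewrite big_split /= [RHS]mulrACA; congr (_ * _); rewrite -prodfV -big_split /=.
apply: eq_bigr => i _; rewrite -prodfV -big_split /=; apply: eq_bigr => j ji.
have nz : 1 - q * (x i * x j) != 0 by apply: bulk_def; rewrite -val_eqE /= neq_ltn ji orbT.
by case: (v (i, _)) (w (j, _)) (v (i, _)) (w (j, _)) => -[] [] [] /=;
  rewrite ?mulr0 ?mulVf // mulrC.
Qed.

Lemma big_subset_splits (R : nmodType) (T : finType) (s : seq T)
    (f : seq T -> seq T -> R) :
  uniq s ->
  \sum_(S : {set T} | S \subset s) f [seq i <- s | i \in S] [seq i <- s | i \notin S] =
  \sum_(p <- splits s) f p.1 p.2.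
Proof.
elim: s f => [|y s IH] f.
  move=> _; rewrite (big_pred1 set0) /= ?big_seq1 // => S.
  by rewrite -[RHS]/(S == set0) -subset0; apply: eq_subset_r => i; rewrite inE.
rewrite cons_uniq => /andP[ys us]; rewrite big_splits_cons big_split.
rewrite (bigID (fun S : {set T} => y \in S)); congr (_ + _).
  rewrite -(IH (fun A B => f (y :: A) B)) //.
  rewrite (reindex_onto (fun S => y |: S) (fun S => S :\ y)) /=; last first.
    by move=> S /andP[_ yS]; rewrite setD1K.
  apply: eq_big => [S|S].
    apply/idP/idP => [/andP[/andP[/subsetP yS _] /eqP e]|/subsetP Ss].
      apply/subsetP => i iS; have := yS i; rewrite !inE iS orbT => /(_ isT) /orP[/eqP iy|//].
      by move: iS; rewrite -e iy !inE eqxx.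
    rewrite setU11 andbT; apply/andP; split.
      apply/subsetP => i; rewrite !inE => /orP[->//|/Ss ->]; exact: orbT.
    by rewrite setU1K //; apply: contra ys; exact: Ss.
  move=> _; rewrite setU11 /=; congr (f (_ :: _) _); apply: eq_in_filter => i si;
    rewrite !inE; by case: eqP => // iy; rewrite iy (negPf ys) in si.
rewrite -(IH (fun A B => f A (y :: B))) //; apply: eq_big => [S|S /andP[_ yS]].
  apply/idP/idP => [/andP[/subsetP sS yS]|/subsetP sS].
    apply/subsetP => i iS; have := sS i iS; rewrite inE => /orP[/eqP iy|//].
    by rewrite -iy iS in yS.
  apply/andP; split; last by apply: contra ys; exact: sS.
  by apply/subsetP => i /sS si; rewrite inE si orbT.
by rewrite /= (negPf yS).
Qed.

Lemma splits_map (T U : Type) (h : T -> U) (s : seq T) :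
  splits (map h s) = [seq (map h p.1, map h p.2) | p <- splits s].
Proof. by elim: s => [|x s IH] //=; rewrite IH map_cat -!map_comp. Qed.

Lemma big_set_splits (R : nmodType) (T : finType) (U : Type) (x : T -> U)
    (f : seq U -> seq U -> R) :
  \sum_(p <- splits [seq x i | i <- enum T]) f p.1 p.2 =
  \sum_(S : {set T}) f [seq x i | i <- enum S] [seq x i | i <- enum (~: S)].
Proof.
rewrite splits_map big_map -(big_subset_splits (fun A B => f (map x A) (map x B)) (enum_uniq _)).
apply: eq_big => [S|S _]; first by apply/subsetP => i _; rewrite mem_enum.
by congr (f (map x _) (map x _)); rewrite enumT; apply: eq_filter => i; rewrite ?inE.
Qed.

Lemma pair_prod_cat (R : comNzRingType) (q : R) (s1 s2 : seq R) :
  pair_prod q (s1 ++ s2) = pair_prod q s1 * pair_prod q s2 *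
    \prod_(x <- s1) \prod_(y <- s2) (1 - q * (x * y)).
Proof.
elim: s1 => [|x s1 IH] /=; first by rewrite big_nil mul1r mulr1.
by rewrite IH big_cat big_cons /=; ring.
Qed.

Lemma alphabet_subalphabet (F : fieldType) (m : nat) (x : 'I_m -> F) (S : {set 'I_m}) :
  alphabet (subalphabet x S) = [seq x i | i <- enum S].
Proof.
rewrite /alphabet /subalphabet (map_comp x); congr map.
(* A default for [nth] exists only when [S] is nonempty. *)
case: (pickP (mem S)) => [i0 _|S0].
  apply: (@eq_from_nth _ i0); first by rewrite size_map size_enum_ord -cardE.
  move=> i; rewrite size_map size_enum_ord => iS.
  by rewrite (nth_map (Ordinal iS)) ?size_enum_ord // (enum_val_nth i0) nth_enum_ord.
have -> : enum S = [::] by apply/eqP; rewrite -size_eq0 -cardE; apply/eqP/eq_card0.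
by apply/eqP; rewrite -size_eq0 size_map size_enum_ord; apply/eqP/eq_card0.
Qed.

Lemma perm_alphabet_split (T : eqType) (m : nat) (x : 'I_m -> T) (S : {set 'I_m}) :
  perm_eq ([seq x i | i <- enum S] ++ [seq x i | i <- enum (~: S)]) (alphabet x).
Proof.
rewrite -map_cat; apply: perm_map; apply: uniq_perm; rewrite ?enum_uniq //.
  rewrite cat_uniq !enum_uniq andbT; apply/hasPn => i.
  by rewrite !mem_enum inE.
by move=> i; rewrite mem_cat !mem_enum inE orbN.
Qed.

Lemma pair_prod_alphabet_neq0 (F : fieldType) (q : F) (m : nat) (x : 'I_m -> F) :
  (forall i j, i != j -> 1 - q * (x i * x j) != 0) -> pair_prod q (alphabet x) != 0.
Proof.
move=> bulk_def; rewrite pair_prod_alphabet.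
apply/prodf_neq0 => i _; apply/prodf_neq0 => j ji.
by apply: bulk_def; rewrite -val_eqE /= neq_ltn ji orbT.
Qed.

(** Away from 1 and -1 the function h is 1, so the boundary matrix is the flip of states, and
    [boundary_num 1 0] is [dcoef] times it. *)
Lemma ZK_Znum (F : fieldType) (q : F) (m : nat) (x : 'I_m -> F) :
  (forall i j, i != j -> 1 - q * (x i * x j) != 0) ->
  (forall i, dcoef (x i) != 0) ->
  ZK q x = (\prod_(i < m) dcoef (x i))^-1 / pair_prod q (alphabet x) *
    Znum q 1 0 (alphabet x).
Proof.
move=> bulk_def dx; rewrite -prodfV; apply: Z_Znum => // i s s'.
have d0 := dx i; have : dcoef (x i) = (1 - x i) * (1 + x i) by rewrite /dcoef; ring.
move=> dE; have /norP[x1 x2] : ~~ ((1 - x i == 0) || (1 + x i == 0)).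
  by rewrite -mulf_eq0 -dE.
have hE : hfun 1 (-1) (x i) = 1.
  have x3 : -1 - x i != 0 by rewrite -opprD oppr_eq0.
  by rewrite /hfun; field; rewrite x1 x3.
have m1 : (1 * -1)^-1 = -1 :> F by rewrite mul1r invrN invr1.
by case: s; case: s'; rewrite /= hE ?m1 ?kcoef10 ?mulrNN ?mul1r ?mulVf // subrr;
  rewrite ?mul0r ?addr0 ?mulr0.
Qed.

Lemma boundary_weight_num (F : fieldType) (a c x : F) (s s' : bool) :
  a != 0 -> c != 0 -> x != a -> x != c ->
  boundary_weight a c x s s' =
  a * c / ((a - x) * (c - x)) *
    boundary_num (1 / - (a * c)) (- (a + c) / (a * c)) x s s'.
Proof.
rewrite ![x == _]eq_sym -!(subr_eq0 _ x) => a0 c0 xa xc.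
by case: s; case: s'; rewrite /= /hfun /kcoef /dcoef; field;
  rewrite ?oppr_eq0 ?mulf_neq0 ?a0 ?c0 ?xa ?xc.
Qed.

Lemma sum_even_subsets (R : comNzRingType) (m : nat) (b : R) (G : {set 'I_m} -> R) :
  \sum_(0 <= r < (m %/ 2).+1) b ^+ r * (\sum_(S : {set 'I_m} | #|S| == (2 * r)%N) G S) =
  \sum_(S : {set 'I_m}) (if odd #|S| then 0 else b ^+ #|S|./2 * G S).
Proof.
under eq_bigr => r _ do rewrite mulr_sumr.
rewrite (exchange_big_dep xpredT) //=; apply: eq_bigr => S _.
have Sm : (#|S| <= m)%N by rewrite -[X in (_ <= X)%N]card_ord max_card.
case: ifP => oS.
  by rewrite big_pred0 // => r; apply: contraTF oS => /eqP ->; rewrite oddM.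
rewrite big_mkord (big_pred1 (inord #|S|./2)) => [|r].
  by rewrite inordK // ltnS divn2 half_leq.
rewrite /= -[RHS]val_eqE /= inordK ?ltnS ?divn2 ?half_leq //.
by apply/eqP/eqP => [->|->]; rewrite mul2n ?doubleK // even_halfK ?oS.
Qed.

(** After [Znum_split_sum] the two sides agree subset by subset: the [kcoef] factors of [Hprod] on
    [S] cancel the denominators of [h / (1 - h)], whose numerators [dcoef] cancel the normalisation
    of [ZK]. *)
Lemma Z_expansion (F : fieldType) (q a c : F) (m : nat) (x : 'I_m -> F) :
  1 != -1 :> F -> a != 0 -> c != 0 ->
  (forall i, x i != a) -> (forall i, x i != c) ->
  (forall i j, i != j -> x i != x j) ->
  (forall i j, i != j -> 1 - q * (x i * x j) != 0) ->
  (forall i, 1 - hfun a c (x i) != 0) ->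
  Z q a c x =
  Hprod a c x *
  \sum_(0 <= r < (m %/ 2).+1)
    (1 / (- (a * c))) ^+ r *
    \sum_(S : {set 'I_m} | #|S| == (2 * r)%N)
      (\prod_(i in S) (hfun a c (x i) / (1 - hfun a c (x i)))) *
      (\prod_(i in S) \prod_(j in ~: S) ((1 - x i * x j) / (x i - x j))) *
      ZK q (subalphabet x S).
Proof.
move=> char2 a0 c0 xa xc x_inj bulk_def h1.
set b := 1 / - (a * c); pose t := - (a + c) / (a * c).
pose g i := a * c / ((a - x i) * (c - x i)).
have gP i s s' : boundary_weight a c (x i) s s' = g i * boundary_num b t (x i) s s'.
  exact: boundary_weight_num.
have kE i : 1 - hfun a c (x i) = g i * kcoef b t (x i) by exact: (gP i false false).
have hE i : hfun a c (x i) = g i * dcoef (x i) by exact: (gP i false true).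
have gk0 i : (g i != 0) && (kcoef b t (x i) != 0) by rewrite -negb_or -mulf_eq0 -kE.
have u_alph : uniq (alphabet x).
  rewrite map_inj_uniq ?enum_uniq // => i j; apply: contra_eq; exact: x_inj.
have P0 := pair_prod_alphabet_neq0 bulk_def.
rewrite (Z_Znum bulk_def gP) Znum_split_sum // /split_sum.
rewrite (big_set_splits x (split_term q b t)) sum_even_subsets !mulr_sumr.
apply: eq_bigr => S _; rewrite /split_term size_map -cardE.
case: ifP => oS; first by rewrite !mulr0.
set A := [seq x i | i <- enum S]; set B := [seq x i | i <- enum (~: S)].
have -> : Hprod a c x = \prod_(i < m) g i * (\prod_(i in S) kcoef b t (x i) *
    \prod_(y <- B) kcoef b t y).
  rewrite /B big_map big_enum /= /Hprod (eq_bigr _ (fun i _ => kE i)) big_split /=.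
  congr (_ * _); rewrite (bigID (mem S)) /=; congr (_ * _).
  by apply: eq_bigl => i; rewrite inE.
have -> : \prod_(i in S) (hfun a c (x i) / (1 - hfun a c (x i))) =
    \prod_(i in S) dcoef (x i) / \prod_(i in S) kcoef b t (x i).
  rewrite -prodfV -big_split /=; apply: eq_bigr => i _.
  by case/andP: (gk0 i) => gi0 ki0; rewrite kE hE invfM mulrACA divff // mul1r.
have -> : \prod_(z <- A) \prod_(y <- B) cross_factor q z y =
    \prod_(i in S) \prod_(j in ~: S) ((1 - x i * x j) / (x i - x j)) *
    \prod_(z <- A) \prod_(y <- B) (1 - q * (z * y)).
  rewrite /A /B !big_map !big_enum -big_split /=; apply: eq_bigr => i _.
  by rewrite !big_map !big_enum -big_split.
have kS0 : \prod_(i in S) kcoef b t (x i) != 0.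
  by apply/prodf_neq0 => i _; case/andP: (gk0 i).
have pAB := perm_alphabet_split x S; rewrite -/A -/B in pAB.
rewrite -(pair_prod_perm q pAB) pair_prod_cat in P0 *.
(* If [S] contains a letter 1 or -1, [ZK] has a value by convention and [ZK_Znum] does not apply,
   but both terms are 0: on one side h vanishes at that letter, on the other [Znum q 1 0] does. *)
case: (boolP [exists i in S, dcoef (x i) == 0]) => [/exists_inP[i iS /eqP d0]|nd].
  have iA : x i \in A by apply: map_f; rewrite mem_enum.
  rewrite (Znum_perm q 1 0 (perm_to_rem iA)) Znum_dcoef0 // kcoef10.
  by rewrite [\prod_(j in S) dcoef (x j)](bigD1 i iS) /= d0 !(mul0r, mulr0).
have dS0 i : i \in S -> dcoef (x i) != 0.
  by move=> iS; apply: contra nd => d0; apply/exists_inP; exists i.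
have -> : ZK q (subalphabet x S) =
    (\prod_(i in S) dcoef (x i))^-1 / pair_prod q A * Znum q 1 0 A.
  rewrite ZK_Znum /subalphabet => [|i j ij|i]; last by apply: dS0; exact: enum_valP.
    rewrite alphabet_subalphabet; congr (_^-1 / _ * _).
    by rewrite [RHS]big_enum_val.
  by apply: bulk_def; apply: contra ij => /eqP /enum_val_inj ->.
have dSn0 : \prod_(i in S) dcoef (x i) != 0 by apply/prodf_neq0.
move: kS0 dSn0 P0; rewrite !mulf_eq0 !negb_or => kS0 dSn0 /andP[/andP[PA0 PB0] PAB0].
move: (\prod_(i in S) kcoef b t (x i)) (\prod_(i in S) dcoef (x i)) (pair_prod q A)
  (pair_prod q B) (\prod_(z <- A) \prod_(y <- B) (1 - q * (z * y))) kS0 dSn0 PA0 PB0 PAB0.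
move: (\prod_(i < m) g i) (\prod_(y <- B) kcoef b t y) (Znum q 1 0 A) (b ^+ _)
  (\prod_(i in S) \prod_(j in ~: S) _) => G KB ZA bn C KS D PA PB PAB KS0 D0 PA0 PB0 PAB0.
by field; rewrite KS0 D0 PA0 PB0 PAB0.
Qed.

Local Open Scope complex_scope.

Theorem theorem4p5 (R : realType) (q a c : R[i]) (m : nat) (x : 'I_m -> R[i])
    (m_ge1 : (1 <= m)%N)
    (a_neq0 : a != 0) (c_neq0 : c != 0)
    (x_neq_a : forall i : 'I_m, x i != a)
    (x_neq_c : forall i : 'I_m, x i != c)
    (x_distinct : forall i j : 'I_m, i != j -> x i != x j)
    (bulk_def : forall i j : 'I_m, i != j -> 1 - q * (x i * x j) != 0)
    (h_neq1 : forall i : 'I_m, 1 - hfun a c (x i) != 0) :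
  Z q a c x =
  Hprod a c x *
  \sum_(0 <= r < (m %/ 2).+1)
    (1 / (- (a * c))) ^+ r *
    \sum_(S : {set 'I_m} | #|S| == (2 * r)%N)
      (\prod_(i in S) (hfun a c (x i) / (1 - hfun a c (x i)))) *
      (\prod_(i in S) \prod_(j in ~: S) ((1 - x i * x j) / (x i - x j))) *
      ZK q (subalphabet x S).
Proof.
apply: Z_expansion => //.
by rewrite -subr_eq0 opprK -[1 + 1]/(2%:R) Num.Theory.pnatr_eq0.
Qed.
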